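(* Let $C\subset[0,1]$ be the middle third Cantor set. Then for any real $t\ge 1$, with respect to the restriction of the $\frac{\log 2}{\log 3}$-dimensional Hausdorff measure to $C+t=\{c+t:c\in C\}$, for almost every $x$ the sequence $(x^n)_{n=1}^{\infty}$ is uniformly distributed modulo one.
   Context: The restriction of the $\frac{\log2}{\log3}$-dimensional Hausdorff measure to $C+t$ is the measure $\mu(A)=\mathcal{H}^{\frac{\log 2}{\log 3}}(A\cap(C+t))$, where $\mathcal{H}^{s}$ denotes $s$-dimensional Hausdorff measure on $\mathbb{R}$. A real sequence $(x_n)_{n=1}^\infty$ is uniformly distributed modulo one if for all $0\le u<v\le 1$, $\lim_{N\to\infty}\frac1N\#\{1\le n\le N: x_n \bmod 1\in[u,v]\}=v-u$. *)

(* Defs.v *)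
From HB Require Import structures.
From mathcomp Require Import all_boot all_order all_algebra.
From mathcomp Require Import all_classical all_reals all_analysis.

Set Implicit Arguments.
Unset Strict Implicit.
Unset Printing Implicit Defensive.

Import Order.TTheory GRing.Theory Num.Theory.
Import numFieldNormedType.Exports.

Local Open Scope classical_set_scope.
Local Open Scope ring_scope.

(* The middle-third construction: removing the open middle third of each of the
   2 ^ k intervals of stage k leaves the union of two copies of stage k scaled
   by 1/3, translated by 0 and 2/3. *)
Fixpoint cantor_stage (R : realType) (k : nat) : set R :=
  if k is k'.+1 then
    [set x / 3 | x in cantor_stage k'] `|`
    [set x / 3 + 2 / 3 | x in cantor_stage k']
  else `[0, 1].
Arguments cantor_stage : clear implicits.

Definition cantor_set (R : realType) : set R := \bigcap_k cantor_stage R k.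
Arguments cantor_set : clear implicits.

(* diam set0 is -oo. *)
Definition diam (R : realType) (U : set R) : \bar R :=
  ereal_sup [set (`|x - y|)%:E | x in U & y in U].

(* The empty set has gauge 0 for every s, including s = 0, where the library
   has (-oo) `^ 0 = 1; a singleton has gauge 0 `^ s, which is 1 for s = 0. *)
Definition hausdorff_gauge (R : realType) (s : R) (U : set R) : \bar R :=
  if U == set0 then 0%E else poweR (diam U) s.

Definition hausdorff_delta (R : realType) (s delta : R) (A : set R) : \bar R :=
  ereal_inf [set (\sum_(n <oo) hausdorff_gauge s (U n))%E |
    U in [set U : (set R)^nat |
            A `<=` \bigcup_n U n /\ forall n, (diam (U n) <= delta%:E)%E]].

(* No normalizing constant. Defined on all subsets of R (as an outer measure). *)
Definition hausdorff_measure (R : realType) (s : R) (A : set R) : \bar R :=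
  ereal_sup [set hausdorff_delta s delta A | delta in [set d : R | 0 < d]].

(* The carrier measurableTypeR R is R with its Borel sigma-algebra, so that
   "almost everywhere" means outside a subset of a Borel set of measure zero. *)
Definition hausdorff_restr (R : realType) (s : R) (D : set R) :
    set (measurableTypeR R) -> \bar R :=
  fun A => hausdorff_measure s (A `&` D).

Definition frac_part (R : realType) (x : R) : R := x - (Num.floor x)%:~R.

(* The sequence is indexed from 1: x 0 is ignored. *)
Definition uniformly_distributed_mod1 (R : realType) (x : nat -> R) : Prop :=
  forall u v : R, 0 <= u -> u < v -> v <= 1 ->
    (fun N : nat =>
       (count (fun n => u <= frac_part (x n) <= v) (iota 1 N))%:R / N%:R : R)
    @ \oo --> v - u.

(* Main.v *)
Require Import Defs.
From HB Require Import structures.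
From mathcomp Require Import all_boot all_order all_algebra.
From mathcomp Require Import all_classical all_reals all_analysis.
From mathcomp Require Import measurable_realfun ring lra.

Import Order.TTheory GRing.Theory Num.Theory.
Import numFieldNormedType.Exports.

Local Open Scope classical_set_scope.
Local Open Scope ring_scope.

(** Write e(y) for exp(2 pi i y). By Weyl's criterion it is enough that, for
    every h >= 1, the sums S_N(x) of e(h x^n) over 1 <= n <= N are o(N) for
    almost every x. This follows, by the argument of Davenport, Erdos and
    LeVeque, from a bound O(N) for the mean of |S_N|^2: Markov's inequality and
    Borel-Cantelli give it along the squares N = k^2, and the gaps between
    consecutive squares are negligible.

    No measure on the Cantor set C has to be constructed. Means are taken over
    the 2^K left endpoints of the intervals of stage K. An interval of stage K
    has length 3^-K, and (3^-K)^s = 2^-K for s = log 2 / log 3, so a set that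
    meets a proportion p of these intervals is covered with s-dimensional sum
    p. A mean over endpoints therefore bounds the Hausdorff premeasure directly
    ([hausdorff_delta_finite_cover], [large_weyl_io_null]).

    The heart of the matter is the decay in m of the mean of e(f(x)) for
    f(x) = h (x^m - x^n) with n < m ([sum_cos_power_gap]). The Fourier transform
    of the Cantor measure does not tend to 0 at infinity, so the convexity of f
    has to be used. Choose k such that 9^k is somewhat larger than f''. On a
    cylinder of depth k with left endpoint a, the phase is then linear up to a
    small error, and the mean of a linear phase over a Cantor set is bounded by
    a product of cosines cos(2 pi xi / 3^i), where xi = f'(a) / 3^k. As a runs
    through the 2^k endpoints of depth k, the frequencies xi are almost
    1-separated and lie in [0, 3^k]. Over all 3^k integers of that range the
    squared product has sum of order (3/2)^k ([sum_prod_cos2_cell]), because the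
    mean of cos^2 is 1/2; so its mean over the 2^k frequencies that do occur is
    of order (3/4)^k, which is a negative power of f''. This is where the
    dimension of C enters: the exponent is negative because log 2 / log 3
    exceeds 1/2.

    The size of f'' varies over C + t by a factor that is exponential in m, and
    the losses above must stay below the gain (3/4)^k. Hence C + t is first cut
    into countably many pieces beta + lam C with beta > 1 and
    beta + lam <= beta w, where w > 1 is so close to 1 that w^32 <= beta. Only
    the point 1, which belongs to C + t when t = 1, lies in none of the pieces. *)

(** * Trigonometric sums *)

Lemma cos_lipschitz (R : realType) (x y : R) : `|cos x - cos y| <= `|x - y|.
Proof.
wlog xy : x y / x <= y => [H|].
  have [|/ltW] := leP x y; first exact: H.
  by rewrite (distrC x) (distrC (cos x)); exact: H.
have dc z : z \in `]x, y[%R -> is_derive z 1 cos (- sin z).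
  by move=> _; exact: is_derive_cos.
have cc : {within `[x, y], continuous cos}.
  by apply: continuous_subspaceT => z; exact: continuous_cos.
have [z _ e] := MVT_segment xy dc cc.
rewrite distrC e (distrC x) normrM normrN ler_piMl//; exact: sin_max.
Qed.

Lemma cosDn2pi (R : realType) (x : R) (n : nat) : cos (x + 2 * pi * n%:R) = cos x.
Proof.
elim: n => [|n IH]; first by rewrite mulr0 addr0.
rewrite -IH -(cosD2pi (x + 2 * pi * n%:R)) -(mulr_natl pi); congr cos.
rewrite -(natr1 n); ring.
Qed.

(** Telescoping by sin(A + B) - sin(A - B) = 2 cos(A) sin(B). The factor
    sin(theta / 2) stays on the left so that the identity also covers
    theta = 0. *)
Lemma sum_cos_arith (R : realType) (phi theta : R) (n : nat) :
  2 * sin (theta / 2) * (\sum_(j < n) cos (phi + theta * j%:R)) =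
  sin (phi + theta * n%:R - theta / 2) - sin (phi - theta / 2).
Proof.
elim: n => [|n IH].
  by rewrite big_ord0 !mulr0 addr0 subrr.
rewrite big_ord_recr /= mulrDr IH.
have -> : phi + theta * n.+1%:R - theta / 2 = phi + theta * n%:R + theta / 2.
  by rewrite -natr1; field.
rewrite !(sinD (phi + theta * n%:R)) sinN cosN; ring.
Qed.

(** * Left endpoints of the Cantor intervals *)

Fixpoint cantor_points (R : realType) (k : nat) : seq R :=
  if k is k'.+1 then
    [seq x / 3 | x <- cantor_points R k'] ++
    [seq x / 3 + 2 / 3 | x <- cantor_points R k']
  else [:: 0].

Lemma size_cantor_points (R : realType) (k : nat) :
  size (cantor_points R k) = (2 ^ k)%N.
Proof.
by elim: k => //= k IH; rewrite size_cat !size_map IH expnS mul2n addnn.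
Qed.

Lemma cantor_points_bounds (R : realType) (k : nat) (x : R) :
  x \in cantor_points R k -> 0 <= x <= 1 - (3 ^+ k)^-1.
Proof.
elim: k x => [|k IH] x /=.
  by rewrite inE => /eqP ->; rewrite expr0 invr1 subrr lexx.
have h : (3 ^+ k.+1 : R)^-1 = (3 ^+ k)^-1 / 3 by rewrite exprS invfM mulrC.
have p : (0 : R) < (3 ^+ k)^-1 by rewrite invr_gt0 exprn_gt0.
rewrite h mem_cat => /orP[] /mapP[y /IH /andP[y0 y1] ->]; lra.
Qed.

Lemma cantor_points_sep (R : realType) (k : nat) (x y : R) :
  x \in cantor_points R k -> y \in cantor_points R k -> x < y ->
  (3 ^+ k)^-1 <= y - x.
Proof.
elim: k x y => [|k IH] x y /=.
  by rewrite !inE => /eqP -> /eqP ->; rewrite ltxx.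
have h : (3 ^+ k.+1 : R)^-1 = (3 ^+ k)^-1 / 3 by rewrite exprS invfM mulrC.
have p : (0 : R) < (3 ^+ k)^-1 by rewrite invr_gt0 exprn_gt0.
have p1 : (3 ^+ k : R)^-1 <= 1.
  by rewrite invf_le1 ?exprn_gt0// exprn_ege1// ler1n.
rewrite h !mem_cat => /orP[] /mapP[u um ->] /orP[] /mapP[v vm ->] xy;
  have /andP[u0 u1] := cantor_points_bounds _ _ _ um;
  have /andP[v0 v1] := cantor_points_bounds _ _ _ vm.
- have := IH u v um vm; lra.
- lra.
- lra.
- have := IH u v um vm; lra.
Qed.

Lemma cantor_points_uniq (R : realType) (k : nat) : uniq (cantor_points R k).
Proof.
elim: k => [//|k IH] /=.
rewrite cat_uniq !map_inj_uniq ?IH ?andbT /=.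
- apply/hasPn => _ /mapP[v vm ->]; apply/mapP => -[u um].
  have /andP[u0 u1] := cantor_points_bounds _ _ _ um.
  have /andP[v0 v1] := cantor_points_bounds _ _ _ vm.
  have p : (0 : R) < (3 ^+ k)^-1 by rewrite invr_gt0 exprn_gt0.
  lra.
- by move=> u v; lra.
- by move=> u v; lra.
Qed.

(** Self-similarity: an endpoint of stage k + l is an endpoint of stage k
    plus a copy, scaled by 3^-k, of an endpoint of stage l. *)
Lemma big_cantor_points_add (R : realType) (k l : nat) (g : R -> R) :
  \sum_(x <- cantor_points R (k + l)) g x =
  \sum_(a <- cantor_points R k) \sum_(c <- cantor_points R l) g (a + c / 3 ^+ k).
Proof.
elim: k g => [|k IH] g.
  rewrite add0n /= big_seq1; apply: eq_bigr => c _.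
  by rewrite expr0 divr1 add0r.
rewrite addSn /= !big_cat !big_map !IH; congr (_ + _);
  apply: eq_bigr => a _; apply: eq_bigr => c _; congr g;
  rewrite exprS; field; by rewrite expf_neq0.
Qed.

(** The uniform measure on the endpoints is a convolution of l two-point
    measures, and cos(A - B) + cos(A + B) = 2 cos(A) cos(B) peels off one of
    them at a time. The phase phi is carried along because each step shifts
    it. *)
Lemma sum_cos_cantor_points (R : realType) (l : nat) (phi xi : R) :
  `|\sum_(c <- cantor_points R l) cos (phi + 2 * pi * xi * c)| <=
  2 ^+ l * \prod_(i < l) `|cos (2 * pi * xi / 3 ^+ i.+1)|.
Proof.
elim: l phi xi => [|l IH] phi xi.
  by rewrite /= big_seq1 big_ord0 expr0 mulr1; exact: cos_max.
rewrite /= big_cat /= !big_map -big_split /=.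
have key c : cos (phi + 2 * pi * xi * (c / 3)) +
            cos (phi + 2 * pi * xi * (c / 3 + 2 / 3)) =
     2 * cos (2 * pi * xi / 3) *
       cos ((phi + 2 * pi * xi / 3) + 2 * pi * (xi / 3) * c).
  pose A := (phi + 2 * pi * xi / 3) + 2 * pi * (xi / 3) * c.
  have -> : phi + 2 * pi * xi * (c / 3) = A - 2 * pi * xi / 3.
    by rewrite /A; field.
  have -> : phi + 2 * pi * xi * (c / 3 + 2 / 3) = A + 2 * pi * xi / 3.
    by rewrite /A; field.
  rewrite -/A cosB cosD; ring.
under eq_bigr => c _ do rewrite key.
rewrite -mulr_sumr !normrM (ger0_norm (_ : 0 <= 2))// big_ord_recl /= expr1.
have -> : \prod_(i < l) `|cos (2 * pi * xi / 3 ^+ (bump 0 i).+1)| =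
          \prod_(i < l) `|cos (2 * pi * (xi / 3) / 3 ^+ i.+1)|.
  apply: eq_bigr => i _; congr `|cos _|.
  by rewrite (exprS _ i.+1); field; rewrite expf_neq0.
apply: le_trans (ler_wpM2l _ (IH _ _)) _; first by rewrite mulr_ge0.
by rewrite le_eqVlt; apply/orP; left; apply/eqP; rewrite exprS; ring.
Qed.

(** The full turns cancel the two ends of the telescoped sum, and
    sin(pi d / Q) does not vanish. *)
Lemma sum_cos_roots (R : realType) (phi : R) (d Q : nat) : (0 < d < Q)%N ->
  \sum_(j < Q) cos (phi + 2 * pi * (d%:R / Q%:R) * j%:R) = 0.
Proof.
move=> /andP[d0 dQ].
have Q0 : (0 : R) < Q%:R by rewrite ltr0n (ltn_trans d0 dQ).
have := sum_cos_arith R phi (2 * pi * (d%:R / Q%:R)) Q.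
set D := _ / 2.
have -> : phi + 2 * pi * (d%:R / Q%:R) * Q%:R - D = (phi - D) + 2 * pi * d%:R.
  by field; rewrite pnatr_eq0 -lt0n (ltn_trans d0 dQ).
rewrite -(cosBpihalf (_ + _)) -(cosBpihalf (phi - D)) addrAC cosDn2pi subrr.
have : 0 < sin D.
  apply: sin_gt0_pi; rewrite /D.
  have -> : 2 * pi * (d%:R / Q%:R) / 2 = pi * (d%:R / Q%:R) :> R.
    by field; rewrite pnatr_eq0 -lt0n (ltn_trans d0 dQ).
  rewrite mulr_gt0 ?pi_gt0 ?divr_gt0 ?ltr0n ?(ltn_trans d0 dQ)//=.
  by rewrite gtr_pMr ?pi_gt0// ltr_pdivrMr// mul1r ltr_nat.
move=> s0 /eqP; rewrite mulf_eq0 mulf_eq0 (gt_eqF s0) pnatr_eq0 /= => /eqP //.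
Qed.

(** * The product of cosines along the integers *)

Lemma sum_sqr_cos_thirds (R : realType) (x : R) :
  cos (2 * pi * x) ^+ 2 + cos (2 * pi * (x + 3^-1)) ^+ 2 +
  cos (2 * pi * (x + 2 / 3)) ^+ 2 = 3 / 2.
Proof.
have h y : cos y ^+ 2 = (1 + cos (2 * y)) / 2 :> R.
  by rewrite (mulr_natl y 2) cos_mulr2n; field.
have := @sum_cos_roots R (2 * (2 * pi * x)) 2 3 isT.
rewrite !big_ord_recl big_ord0 /= /bump /= !addn0 mulr0 addr0 !h.
have -> : 2 * (2 * pi * x) + 2 * pi * (2 / 3) * (1 + 0)%:R = 2 * (2 * pi * (x + 3^-1)).
  by rewrite addn0; field.
have -> : 2 * (2 * pi * x) + 2 * pi * (2 / 3) * (1 + 1)%:R = 2 * (2 * pi * (x + 2 / 3)).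
  by field.
lra.
Qed.

(** An upper bound for cos(2 pi x / 3^(q+1))^2 on the whole cell
    j <= x <= j + 1: the value at j plus a Lipschitz constant. Replacing the
    cosine by this bound reduces sums over irregularly placed frequencies to
    sums over integers. *)
Definition cos2_cell (R : realType) (q j : nat) : R :=
  cos (2 * pi * j%:R / 3 ^+ q.+1) ^+ 2 + 4 * pi / 3 ^+ q.+1.

Lemma cos2_cell_ge0 (R : realType) (q j : nat) : 0 <= cos2_cell R q j.
Proof.
by rewrite addr_ge0 ?sqr_ge0// divr_ge0 ?exprn_ge0// mulr_ge0 ?pi_ge0.
Qed.

Lemma cos2_cell_ge (R : realType) (q j : nat) (x : R) : j%:R <= x <= j%:R + 1 ->
  cos (2 * pi * x / 3 ^+ q.+1) ^+ 2 <= cos2_cell R q j.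
Proof.
move=> /andP[jx xj]; rewrite /cos2_cell -lerBlDl subr_sqr.
have p3 : (0 : R) < 3 ^+ q.+1 by rewrite exprn_gt0.
apply: le_trans (ler_norm _) _; rewrite normrM.
have h1 := cos_lipschitz R (2 * pi * x / 3 ^+ q.+1) (2 * pi * j%:R / 3 ^+ q.+1).
have h2 : `|cos (2 * pi * x / 3 ^+ q.+1) + cos (2 * pi * j%:R / 3 ^+ q.+1)| <= 2 :> R.
  apply: le_trans (ler_normD _ _) _.
  have := cos_max (2 * pi * x / 3 ^+ q.+1 : R).
  have := cos_max (2 * pi * j%:R / 3 ^+ q.+1 : R); lra.
apply: le_trans (ler_pM _ _ h1 h2) _ => //.
have -> : 2 * pi * x / 3 ^+ q.+1 - 2 * pi * j%:R / 3 ^+ q.+1 =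
  2 * pi / 3 ^+ q.+1 * (x - j%:R) by field; rewrite gt_eqF.
have p0 : 0 <= 2 * pi / 3 ^+ q.+1 :> R by rewrite divr_ge0 ?mulr_ge0 ?pi_ge0 ?ltW.
rewrite normrM !ger0_norm ?subr_ge0//.
have -> : 4 * pi / 3 ^+ q.+1 = 2 * pi / 3 ^+ q.+1 * 1 * 2 :> R by field; rewrite gt_eqF.
by rewrite ler_wpM2r// ler_wpM2l//; lra.
Qed.

Lemma cos2_cell_periodic (R : realType) (q j n : nat) :
  cos2_cell R q (j + 3 ^ q.+1 * n) = cos2_cell R q j.
Proof.
rewrite /cos2_cell; congr (_ ^+ 2 + _).
rewrite natrD natrM natrX -(cosDn2pi _ (2 * pi * j%:R / _) n); congr cos.
by field; rewrite expf_neq0.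
Qed.

(** Translation by 3^q turns the angle 2 pi j / 3^(q+1) by a third of a
    circle, and cos^2 has mean 1/2 over three equally spaced angles. *)
Lemma sum_cos2_cell_thirds (R : realType) (q j : nat) :
  cos2_cell R q j + cos2_cell R q (j + 3 ^ q) + cos2_cell R q (j + 3 ^ q * 2) =
  3 / 2 * (1 + 8 * pi / 3 ^+ q.+1).
Proof.
rewrite /cos2_cell !natrD natrM natrX.
have p3 : (3 ^+ q.+1 : R) != 0 by rewrite expf_neq0.
have p3' : (3 ^+ q : R) != 0 by rewrite expf_neq0.
have := sum_sqr_cos_thirds R (j%:R / 3 ^+ q.+1).
have -> : 2 * pi * (j%:R / 3 ^+ q.+1) = 2 * pi * j%:R / 3 ^+ q.+1 :> R by field.
have -> : 2 * pi * (j%:R / 3 ^+ q.+1 + 3^-1) = 2 * pi * (j%:R + 3 ^+ q) / 3 ^+ q.+1 :> R.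
  by rewrite exprS; field.
have -> : 2 * pi * (j%:R / 3 ^+ q.+1 + 2 / 3) = 2 * pi * (j%:R + 3 ^+ q * 2) / 3 ^+ q.+1 :> R.
  by rewrite exprS; field.
rewrite -!mulrA; lra.
Qed.

Lemma big_ord_thirds (V : nmodType) (n : nat) (F : nat -> V) :
  \sum_(j < 3 * n) F j = \sum_(j < n) (F j + F (j + n)%N + F (j + n * 2)%N).
Proof.
have -> : (3 * n = n + (n + n))%N by rewrite mulSn mul2n addnn.
rewrite !big_split_ord /= -!big_split /=; apply: eq_bigr => j _.
by rewrite addrA (addnC n j) addnCA addnn muln2.
Qed.

(** The factors of index i < q have period 3^q, so the residues modulo 3^q
    and the three translates by multiples of 3^q separate, and the sum is
    multiplied by 3/2 (1 + 8 pi / 3^(q+1)) at each step. The product of the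
    corrections converges; the exponential bounds its partial products. *)
Lemma sum_prod_cos2_cell (R : realType) (q : nat) :
  \sum_(j < 3 ^ q) \prod_(i < q) cos2_cell R i j <=
  (3 / 2) ^+ q * expR (4 * pi * (1 - (3 ^+ q)^-1)).
Proof.
elim: q => [|q IH].
  by rewrite big_ord1 big_ord0 expr0 invr1 subrr mulr0 expR0 mulr1.
rewrite expnS (@big_ord_thirds R _ (fun j => \prod_(i < q.+1) cos2_cell R i j)).
have -> : \sum_(j < 3 ^ q) (\prod_(i < q.+1) cos2_cell R i j +
      \prod_(i < q.+1) cos2_cell R i (j + 3 ^ q) +
      \prod_(i < q.+1) cos2_cell R i (j + 3 ^ q * 2)) =
    (3 / 2 * (1 + 8 * pi / 3 ^+ q.+1)) *
    \sum_(j < 3 ^ q) \prod_(i < q) cos2_cell R i j.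
  rewrite mulr_sumr; apply: eq_bigr => j _; rewrite -(sum_cos2_cell_thirds R q j).
  have per n : \prod_(i < q) cos2_cell R i (j + 3 ^ q * n) = \prod_(i < q) cos2_cell R i j.
    apply: eq_bigr => -[i iq] _ /=.
    have -> : (3 ^ q * n = 3 ^ i.+1 * (3 ^ (q - i.+1) * n))%N.
      by rewrite mulnA -expnD subnKC.
    exact: cos2_cell_periodic.
  have := per 1%N; rewrite muln1 => per1.
  by rewrite !big_ord_recr /= per1 per; ring.
have p3 : (0 : R) < 3 ^+ q by rewrite exprn_gt0.
have e0 : 0 <= 8 * pi / 3 ^+ q.+1 :> R.
  by rewrite divr_ge0 ?mulr_ge0 ?pi_ge0 ?exprn_ge0.
apply: le_trans (ler_wpM2l _ IH) _; first lra.
have -> : 4 * pi * (1 - (3 ^+ q.+1)^-1) =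
          8 * pi / 3 ^+ q.+1 + 4 * pi * (1 - (3 ^+ q)^-1) :> R.
  by rewrite exprS; field; rewrite gt_eqF.
have := expR_ge1Dx (8 * pi / 3 ^+ q.+1 : R).
rewrite expRD; set e := 8 * pi / _; set E := expR (4 * _ * _) => eE.
have -> : (3 / 2) ^+ q.+1 * (expR e * E) = (3 / 2) ^+ q.+1 * E * expR e by ring.
have -> : 3 / 2 * (1 + e) * ((3 / 2) ^+ q * E) = (3 / 2) ^+ q.+1 * E * (1 + e).
  by rewrite exprS; ring.
by rewrite ler_wpM2l// mulr_ge0 ?exprn_ge0 ?expR_ge0.
Qed.

(** * Means of linear phases with separated frequencies *)

Lemma ler_sum_inj_seq (R : realType) (s : seq R) (f : R -> nat) (M : nat)
    (G : nat -> R) : uniq s -> {in s &, injective f} ->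
  (forall x, x \in s -> (f x < M)%N) -> (forall u, 0 <= G u) ->
  \sum_(x <- s) G (f x) <= \sum_(u < M) G u.
Proof.
move=> us inj ltM G0.
rewrite -(big_map f xpredT) -(big_mkord xpredT G).
have uf : uniq (map f s) by rewrite map_inj_in_uniq.
have p : perm_eq (map f s) [seq u <- index_iota 0 M | u \in map f s].
  apply: uniq_perm => //; first by rewrite filter_uniq// iota_uniq.
  move=> u; rewrite mem_filter mem_index_iota /=.
  by case: (boolP (u \in _)) => //= /mapP[x xs ->]; rewrite ltM.
rewrite (perm_big _ p) big_filter [leRHS](bigID (fun u => u \in map f s)) /=.
by rewrite lerDl sumr_ge0.
Qed.

Lemma sum_divn (R : realType) (n L : nat) (G : nat -> R) : (0 < L)%N ->
  \sum_(u < n * L) G (u %/ L)%N = L%:R * \sum_(j < n) G j.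
Proof.
move=> L0; elim: n => [|n IH]; first by rewrite !big_ord0 mulr0.
rewrite mulSnr big_split_ord /= IH big_ord_recr /= mulrDr; congr (_ + _).
under eq_bigr => j _ do rewrite divnMDl// divn_small// addn0.
by rewrite sumr_const card_ord mulr_natl.
Qed.

(** The map sending a to the integer part of L xi(a) is injective by
    separation, and at most L of its values fall into one unit cell. *)
Lemma sum_prod_cos2_separated (R : realType) (k L : nat) (xi : R -> R) :
  (0 < L)%N ->
  (forall a, a \in cantor_points R k -> 0 <= xi a < 3 ^+ k) ->
  (forall a b, a \in cantor_points R k -> b \in cantor_points R k -> a < b ->
     L%:R^-1 <= xi b - xi a) ->
  \sum_(a <- cantor_points R k) \prod_(i < k) cos (2 * pi * xi a / 3 ^+ i.+1) ^+ 2
  <= L%:R * ((3 / 2) ^+ k * expR (4 * pi)).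
Proof.
move=> L0 bnd sep.
have L0r : (0 : R) < L%:R by rewrite ltr0n.
pose f a := Num.truncn (xi a * L%:R).
pose G j := \prod_(i < k) cos2_cell R i j.
have fP a : a \in cantor_points R k -> (f a)%:R <= xi a * L%:R < (f a).+1%:R.
  by move=> /bnd /andP[x0 _]; rewrite truncn_itv// mulr_ge0// ler0n.
apply: (@le_trans _ _ (\sum_(a <- cantor_points R k) G (f a %/ L)%N)).
  rewrite !big_seq; apply: ler_sum => a ak; apply: ler_prod => i _.
  rewrite sqr_ge0/=; apply: cos2_cell_ge.
  have /andP[f1 f2] := fP a ak; apply/andP; split.
    rewrite -(ler_pM2r L0r) (le_trans _ f1)// -natrM ler_nat; exact: leq_trunc_div.
  rewrite -(ler_pM2r L0r) (le_trans (ltW f2))// natr1 -natrM ler_nat.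
  by rewrite ltn_ceil.
apply: le_trans (@ler_sum_inj_seq R _ f (3 ^ k * L) (fun u => G (u %/ L)%N) _ _ _ _) _.
- exact: cantor_points_uniq.
- have h a b : a \in cantor_points R k -> b \in cantor_points R k -> a < b -> f a != f b.
    move=> ak bk ab; apply/eqP => fab.
    have := sep a b ak bk ab; rewrite -(ler_pM2r L0r) mulVf ?gt_eqF// mulrBl.
    have /andP[_ f2] := fP b bk; have /andP[f1 _] := fP a ak.
    by move: f1 f2; rewrite fab -natr1; lra.
  move=> a b ak bk fab; have [ab|ab|//] := ltgtP a b.
    by have := h a b ak bk ab; rewrite fab eqxx.
  by have := h b a bk ak ab; rewrite fab eqxx.
- move=> a ak; have /andP[f1 _] := fP a ak.
  rewrite -(ltr_nat R) (le_lt_trans f1)// natrM natrX ltr_pM2r//.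
  by have /andP[] := bnd a ak.
- by move=> u; rewrite prodr_ge0// => i _; exact: cos2_cell_ge0.
- rewrite sum_divn// ler_wpM2l ?ler0n//.
  apply: le_trans (sum_prod_cos2_cell R k) _.
  rewrite ler_wpM2l ?exprn_ge0// ler_expR ler_piMr ?mulr_ge0 ?pi_ge0 //
    lerBlDr lerDl invr_ge0 exprn_ge0.
Qed.

(** The inner sums are bounded by products p of cosines whose squares
    [sum_prod_cos2_separated] controls. In place of the Cauchy-Schwarz
    inequality, p <= tau + p^2 / tau is used with a free parameter tau. *)
Lemma sum_cos_linear_phases (R : realType) (k l L : nat) (phi xi : R -> R) (tau : R) :
  (0 < L)%N -> 0 < tau ->
  (forall a, a \in cantor_points R k -> 0 <= xi a < 3 ^+ k) ->
  (forall a b, a \in cantor_points R k -> b \in cantor_points R k -> a < b ->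
     L%:R^-1 <= xi b - xi a) ->
  `|\sum_(a <- cantor_points R k) \sum_(c <- cantor_points R (k + l))
      cos (phi a + 2 * pi * xi a * c)|
  <= 2 ^+ (k + (k + l)) *
     (tau + L%:R * (3 / 4) ^+ k * expR (4 * pi) / tau).
Proof.
move=> L0 t0 bnd sep.
apply: le_trans (ler_norm_sum _ _ _) _.
pose p a := \prod_(i < k) `|cos (2 * pi * xi a / 3 ^+ i.+1)|.
have p2 a : p a ^+ 2 = \prod_(i < k) cos (2 * pi * xi a / 3 ^+ i.+1) ^+ 2.
  by rewrite -prodrXl; apply: eq_bigr => i _; rewrite real_normK// num_real.
have p0 a : 0 <= p a by rewrite prodr_ge0.
apply: (@le_trans _ _ (\sum_(a <- cantor_points R k) 2 ^+ (k + l) *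
          (tau + p a ^+ 2 / tau))).
  apply: ler_sum => a _; apply: le_trans (sum_cos_cantor_points _ _ _ _) _.
  rewrite ler_wpM2l ?exprn_ge0// big_split_ord /=.
  apply: (@le_trans _ _ (p a)).
    apply: ler_piMr (p0 a) _; apply: prodr_ile1 => i _.
    by rewrite normr_ge0 cos_max.
  rewrite -(ler_pM2r t0) mulrDl divfK ?gt_eqF//.
  have := sqr_ge0 (p a - tau); have := p0 a; nra.
rewrite -mulr_sumr (exprD _ k (k + l)) (mulrC (2 ^+ k)) -[leRHS]mulrA ler_wpM2l ?exprn_ge0//.
rewrite big_split /= big_const_seq count_predT iter_addr_0 size_cantor_points.
rewrite mulrDr -(mulr_natl tau) natrX lerD2l -mulr_suml.
have := @sum_prod_cos2_separated R k L xi L0 bnd sep.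
under [in X in X -> _]eq_bigr => a _ do rewrite -p2.
rewrite -(ler_pM2r (_ : 0 < tau^-1)) ?invr_gt0// => h; apply: le_trans h _.
have -> : (3 / 2 : R) ^+ k = 2 ^+ k * (3 / 4) ^+ k.
  by rewrite -exprMn; congr (_ ^+ k); field.
by rewrite le_eqVlt; apply/orP; left; apply/eqP; ring.
Qed.

(** * The gap between two powers of x *)

(** Writing r(m) for the remainder, r(m+1) = (x + e) r(m) + m x^(m-1) e^2,
    which is proved by algebra alone and gives positivity and the upper bound
    at once. *)
Lemma exprn_taylor2 (R : realType) (x e X : R) (m : nat) :
  0 <= x -> 0 <= e -> x + e <= X -> 1 <= X ->
  0 <= (x + e) ^+ m - x ^+ m - m%:R * x ^+ m.-1 * e <= m%:R ^+ 2 * X ^+ m * e ^+ 2.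
Proof.
move=> x0 e0 xX X1; elim: m => [|m /andP[IH1 IH2]].
  by rewrite !expr0 mulr0n expr0n /= !mul0r subrr subr0 lexx.
set r := (x + e) ^+ m - _ - _ in IH1 IH2.
have -> : (x + e) ^+ m.+1 - x ^+ m.+1 - m.+1%:R * x ^+ m.+1.-1 * e =
          (x + e) * r + m%:R * x ^+ m.-1 * e ^+ 2.
  rewrite /r -natr1 /=; case: (m) => [|m']; first by rewrite !expr0 expr1; ring.
  by rewrite -natr1 /= !exprS; ring.
have xm : x ^+ m.-1 <= X ^+ m.
  apply: (@le_trans _ _ (X ^+ m.-1)); first by apply: lerXn2r; rewrite ?nnegrE; lra.
  by rewrite ler_weXn2l// leq_pred.
have xm0 : 0 <= x ^+ m.-1 by rewrite exprn_ge0.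
have Xm0 : 0 <= X ^+ m by rewrite exprn_ge0//; lra.
have m0 : 0 <= m%:R :> R by rewrite ler0n.
have e20 : 0 <= e ^+ 2 by rewrite sqr_ge0.
apply/andP; split; first by rewrite addr_ge0// mulr_ge0//; [lra|rewrite mulr_ge0].
apply: (@le_trans _ _ (X * (m%:R ^+ 2 * X ^+ m * e ^+ 2) + m%:R * X ^+ m * e ^+ 2)).
  apply: lerD; first by apply: ler_pM => //; lra.
  by rewrite ler_wpM2r// ler_wpM2l.
have XX : X ^+ m <= X ^+ m.+1 by rewrite ler_weXn2l.
apply: (@le_trans _ _ ((m%:R ^+ 2 + m%:R) * X ^+ m.+1 * e ^+ 2)).
  have -> : X * (m%:R ^+ 2 * X ^+ m * e ^+ 2) = m%:R ^+ 2 * X ^+ m.+1 * e ^+ 2.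
    by rewrite (exprS X); ring.
  by rewrite !mulrDl lerD2l ler_wpM2r// ler_wpM2l.
rewrite ler_wpM2r// ler_wpM2r//; first by rewrite exprn_ge0//; lra.
by rewrite -natr1; lra.
Qed.

Definition power_gap_deriv (R : realType) (m n : nat) (x : R) : R :=
  m%:R * x ^+ m.-1 - n%:R * x ^+ n.-1.

Lemma power_gap_taylor (R : realType) (m n : nat) (x e X : R) : (n <= m)%N ->
  0 <= x -> 0 <= e -> x + e <= X -> 1 <= X ->
  `|((x + e) ^+ m - (x + e) ^+ n) -
    (x ^+ m - x ^+ n + power_gap_deriv R m n x * e)| <= m%:R ^+ 2 * X ^+ m * e ^+ 2.
Proof.
move=> nm x0 e0 xX X1.
have /andP[m1 m2] := @exprn_taylor2 R x e X m x0 e0 xX X1.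
have /andP[n1 n2] := @exprn_taylor2 R x e X n x0 e0 xX X1.
have h : n%:R ^+ 2 * X ^+ n * e ^+ 2 <= m%:R ^+ 2 * X ^+ m * e ^+ 2.
  rewrite ler_wpM2r ?sqr_ge0// ler_pM ?sqr_ge0 ?exprn_ge0//; first lra.
    by rewrite lerXn2r ?nnegrE ?ler0n// ler_nat.
  by rewrite ler_weXn2l.
rewrite /power_gap_deriv ler_norml mulrBl; apply/andP; split; lra.
Qed.

Lemma power_gap_deriv_bounds (R : realType) (m n : nat) (x : R) : (n < m)%N ->
  1 <= x -> 0 <= power_gap_deriv R m n x <= m%:R * x ^+ m.
Proof.
move=> nm x1; have x0 : 0 <= x by lra.
have h : n%:R * x ^+ n.-1 <= m%:R * x ^+ m.-1.
  rewrite ler_pM ?ler0n ?exprn_ge0// ?ler_nat 1?ltnW//.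
  by rewrite ler_weXn2l// -!subn1 leq_sub2r// ltnW.
have h2 : m%:R * x ^+ m.-1 <= m%:R * x ^+ m.
  by rewrite ler_wpM2l ?ler0n// ler_weXn2l// leq_pred.
have h3 : 0 <= n%:R * x ^+ n.-1 by rewrite mulr_ge0 ?ler0n ?exprn_ge0.
rewrite /power_gap_deriv; apply/andP; split; lra.
Qed.

(** A lower bound x^(m-2) for the second derivative of x^m - x^n, in integrated
    form. With D(j) = y^j - x^j the difference of the two values is
    m D(m-1) - n D(n-1), and D is nondecreasing in j for 1 <= x <= y. *)
Lemma power_gap_deriv_incr (R : realType) (m n : nat) (x y : R) :
  (0 < n < m)%N -> 1 <= x -> x <= y ->
  (y - x) * x ^+ m.-2 <= power_gap_deriv R m n y - power_gap_deriv R m n x.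
Proof.
case: m => [|[|m]]; first by rewrite ltn0 andbF.
  by case: n => [|n] //; rewrite ltnS ltn0 andbF.
case: n => [//|n]; rewrite ltnS /= => nm x1 xy.
have x0 : 0 <= x by lra.
have y0 : 0 <= y by lra.
pose D j := y ^+ j - x ^+ j.
have D0 j : 0 <= D j by rewrite subr_ge0 lerXn2r ?nnegrE.
have DS j : D j <= D j.+1.
  have : x ^+ j * 1 <= x ^+ j * x by rewrite ler_wpM2l ?exprn_ge0.
  have : y * (y ^+ j - x ^+ j) >= 1 * (y ^+ j - x ^+ j).
    by rewrite ler_wpM2r ?D0//; lra.
  have : 0 <= x ^+ j * (y - x) by rewrite mulr_ge0 ?exprn_ge0//; lra.
  rewrite /D !exprS; lra.
have DM i j : (i <= j)%N -> D i <= D j.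
  by move/subnKC <-; elim: (j - i)%N => [|d IH]; rewrite ?addn0// addnS (le_trans IH).
have e1 : (y - x) * x ^+ m <= D m.+1.
  have : x ^+ m * y <= y ^+ m * y by rewrite ler_wpM2r// lerXn2r ?nnegrE.
  rewrite /D !exprS; lra.
apply: le_trans e1 _.
have -> : power_gap_deriv R m.+2 n.+1 y - power_gap_deriv R m.+2 n.+1 x =
  m.+2%:R * D m.+1 - n.+1%:R * D n by rewrite /power_gap_deriv /D /=; ring.
have : n.+1%:R * D n <= m.+1%:R * D m.+1.
  by rewrite ler_pM ?ler0n// ?ler_nat// DM// ltnW.
rewrite -[m.+2%:R]natr1 mulrDl; lra.
Qed.

(** * Decay of the correlations *)

Lemma exists_pow9 (R : realType) (Y : R) : 1 <= Y ->
  exists k : nat, Y <= 9 ^+ k <= 9 * Y.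
Proof.
move=> Y1.
have ex : exists k, Y <= 9 ^+ k.
  exists (Num.truncn Y).+1; apply/ltW/(lt_trans (truncnS_gt Y)).
  by rewrite -natrX ltr_nat ltn_expl.
case: (ex_minnP ex) => -[|k] Yk min; first by exists 0%N; rewrite Yk expr0; lra.
exists k.+1; rewrite Yk exprS ler_wpM2l//.
by case: (leP (9 ^+ k) Y) => // /ltW /min; rewrite ltnn.
Qed.

(** The bound described at the top of the file, with the losses made explicit.
    The depth k is fixed by requiring 9^k to be of size
    h m^2 (beta + lam)^m w^m, which exceeds the second derivative of
    h (x^m - x^n) by the factor w^m that makes the linearisation error O(w^-m).
    The same factor and the ratio ((beta + lam) / beta)^m <= w^m weaken the
    separation of the frequencies to about w^(-2m). Against this, (3/4)^k is at
    most w^(-4m), so the choice tau = w^-m leaves m^2 w^-m. *)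
Lemma sum_cos_power_gap (R : realType) (beta lam w : R) (h m n k l : nat) :
  1 < beta -> 0 < lam -> lam <= 1 -> 1 < w -> w ^+ 32 <= beta ->
  beta + lam <= beta * w -> (0 < h)%N -> (0 < n < m)%N ->
  h%:R * m%:R ^+ 2 * (beta + lam) ^+ m * w ^+ m <= 9 ^+ k ->
  9 ^+ k <= 9 * (h%:R * m%:R ^+ 2 * (beta + lam) ^+ m * w ^+ m) ->
  `|\sum_(c <- cantor_points R (k + (k + l)))
      cos (2 * pi * h%:R * ((beta + lam * c) ^+ m - (beta + lam * c) ^+ n))| <=
  2 ^+ (k + (k + l)) *
  ((2 * pi + 1 + (9 * beta ^+ 2 / lam ^+ 2 + 1) * expR (4 * pi)) *
   m%:R ^+ 2 / w ^+ m).
Proof.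
move=> b1 l0 l1 w1 wb bw h0 nm Yk kY.
have /andP[n0 ltnm] := nm.
set X := beta + lam in bw Yk kY *.
have X1 : 1 <= X by rewrite /X; lra.
have X0 : 0 <= X by lra.
have h1 : 1 <= h%:R :> R by rewrite ler1n.
have m1 : 1 <= m%:R :> R by rewrite ler1n; apply: leq_trans ltnm.
have m0 : 0 <= m%:R :> R by lra.
have m21 : 1 <= m%:R ^+ 2 :> R by rewrite exprn_ege1.
have Xm1 : 1 <= X ^+ m by rewrite exprn_ege1.
have wm1 : 1 < w ^+ m by rewrite exprn_egt1// -lt0n (leq_trans _ ltnm).
have wm0 : 0 < w ^+ m by lra.
have p3 : 0 < 3 ^+ k :> R by rewrite exprn_gt0.
have p9 : 9 ^+ k = 3 ^+ k * 3 ^+ k :> R by rewrite -exprMn; congr (_ ^+ k); ring.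
have p90 : 0 < 9 ^+ k :> R by rewrite exprn_gt0.
have pib a : a \in cantor_points R k -> 1 <= beta + lam * a /\ beta + lam * a <= X.
  move=> /cantor_points_bounds /andP[a0 a1].
  have : 0 < (3 ^+ k)^-1 :> R by rewrite invr_gt0.
  rewrite /X; split; nra.
pose xi a := h%:R * power_gap_deriv R m n (beta + lam * a) * lam / 3 ^+ k.
pose phi a := 2 * pi * h%:R * ((beta + lam * a) ^+ m - (beta + lam * a) ^+ n).
pose L := (Num.truncn (9 * beta ^+ 2 * m%:R ^+ 2 * w ^+ m ^+ 2 / lam ^+ 2)).+1.
have lin := @sum_cos_linear_phases R k l L phi xi (w ^+ m)^-1 isT.
have bndxi a : a \in cantor_points R k -> 0 <= xi a < 3 ^+ k.
  move=> /pib [xa1 xaX].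
  have /andP[d0 d1] := @power_gap_deriv_bounds R m n _ ltnm xa1.
  rewrite /xi divr_ge0 ?(ltW p3) ?mulr_ge0 ?ler0n// ?(ltW l0)//=.
  rewrite ltr_pdivrMr// -p9; apply: lt_le_trans Yk.
  apply: (@le_lt_trans _ _ (h%:R * (m%:R ^+ 2 * X ^+ m))); last first.
    rewrite mulrA ltr_pMr//; apply: mulr_gt0; last lra.
    by apply: mulr_gt0; lra.
  rewrite -mulrA ler_wpM2l ?ler0n// -[leRHS]mulr1 ler_pM ?(ltW l0)//.
  apply: le_trans d1 _; rewrite ler_pM ?exprn_ge0//; first lra.
    by rewrite expr2 ler_peMl.
  by rewrite lerXn2r ?nnegrE//; lra.
(* The gap is at least lam^2 / (9 beta^2 m^2 w^(2m)): 9 comes from rounding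
   9^k, and beta^2 from the exponent m - 2 of the second derivative. *)
have sepxi a b : a \in cantor_points R k -> b \in cantor_points R k -> a < b ->
    L%:R^-1 <= xi b - xi a.
  move=> ak bk ab.
  have [xa1 xaX] := pib a ak; have [xb1 xbX] := pib b bk.
  have sp := cantor_points_sep R k a b ak bk ab.
  have xab : beta + lam * a <= beta + lam * b by rewrite lerD2l ler_wpM2l ?(ltW l0) ?ltW.
  have inc := @power_gap_deriv_incr R m n _ _ nm xa1 xab.
  have bm : beta ^+ m = beta ^+ 2 * beta ^+ m.-2.
    by rewrite -exprD; congr (_ ^+ _); move: n0 ltnm; case: (m) (n) => [|[|m']] [|n'].
  have bm0 : 0 < beta ^+ m.-2 by rewrite exprn_gt0//; lra.
  have low : h%:R * (lam / 3 ^+ k * beta ^+ m.-2) * lam / 3 ^+ k <= xi b - xi a.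
    have -> : xi b - xi a = h%:R * (power_gap_deriv R m n (beta + lam * b) -
       power_gap_deriv R m n (beta + lam * a)) * lam / 3 ^+ k by rewrite /xi; ring.
    rewrite ler_pM2r ?invr_gt0// ler_pM2r// ler_pM2l ?ltr0n//.
    apply: le_trans inc; rewrite ler_pM ?(ltW bm0) ?divr_ge0 ?(ltW l0) ?(ltW p3)//.
      have -> : beta + lam * b - (beta + lam * a) = lam * (b - a) by ring.
      by rewrite ler_pM2l.
    apply: lerXn2r; rewrite ?nnegrE; [lra|lra|].
    have /andP[a0 _] := cantor_points_bounds _ _ _ ak.
    by rewrite lerDl mulr_ge0// ltW.
  apply: le_trans low.
  have -> : h%:R * (lam / 3 ^+ k * beta ^+ m.-2) * lam / 3 ^+ k =
     h%:R * lam ^+ 2 * beta ^+ m.-2 / 9 ^+ k by rewrite p9; field; rewrite gt_eqF.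
  rewrite ler_pdivlMr// mulrC ler_pdivrMr ?ltr0n//.
  apply: le_trans kY _.
  have trc : 9 * beta ^+ 2 * m%:R ^+ 2 * w ^+ m ^+ 2 / lam ^+ 2 <= L%:R.
    exact/ltW/truncnS_gt.
  have XB : X ^+ m <= beta ^+ 2 * beta ^+ m.-2 * w ^+ m.
    by rewrite -bm -exprMn lerXn2r// ?nnegrE//; lra.
  apply: (@le_trans _ _ (h%:R * lam ^+ 2 * beta ^+ m.-2 *
     (9 * beta ^+ 2 * m%:R ^+ 2 * w ^+ m ^+ 2 / lam ^+ 2))); last first.
    rewrite ler_wpM2l// mulr_ge0 ?mulr_ge0 ?sqr_ge0 ?ler0n//; exact: ltW.
  have -> : h%:R * lam ^+ 2 * beta ^+ m.-2 *
     (9 * beta ^+ 2 * m%:R ^+ 2 * w ^+ m ^+ 2 / lam ^+ 2) =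
     9 * (h%:R * m%:R ^+ 2 * (beta ^+ 2 * beta ^+ m.-2 * w ^+ m) * w ^+ m).
    by field; rewrite gt_eqF.
  by rewrite ler_wpM2l// ler_wpM2r ?(ltW wm0)// ler_wpM2l// mulr_ge0 ?ler0n.
have := lin (_ : 0 < _) bndxi sepxi; rewrite invr_gt0 => /(_ wm0) {}lin.
rewrite big_cantor_points_add.
set S := \sum_(a <- _) _; set S' := \sum_(a <- _) _ in lin.
have dist : `|S - S'| <= 2 ^+ (k + (k + l)) * (2 * pi / w ^+ m).
  rewrite /S /S' -sumrB; apply: le_trans (ler_norm_sum _ _ _) _.
  have -> : 2 ^+ (k + (k + l)) * (2 * pi / w ^+ m) =
    \sum_(a <- cantor_points R k) \sum_(c <- cantor_points R (k + l)) 2 * pi / w ^+ m.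
    rewrite !big_const_seq !count_predT !iter_addr_0 !size_cantor_points.
    by rewrite -mulrnA mulnC -expnD -natrX mulr_natl.
  rewrite !big_seq; apply: ler_sum => a ak; rewrite -sumrB.
  apply: le_trans (ler_norm_sum _ _ _) _.
  rewrite !big_seq; apply: ler_sum => c ck.
  have [xa1 xaX] := pib a ak.
  have /andP[a0 a1] := cantor_points_bounds _ _ _ ak.
  have /andP[c0 c1] := cantor_points_bounds _ _ _ ck.
  have c11 : c <= 1.
    by apply: le_trans c1 _; rewrite lerBlDr lerDl invr_ge0 exprn_ge0.
  have e0 : 0 <= lam * c / 3 ^+ k by rewrite divr_ge0 ?mulr_ge0// ltW.
  have eX : beta + lam * a + lam * c / 3 ^+ k <= X.
    rewrite /X -addrA lerD2l -mulrA -mulrDr ger_pMr//.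
    have : c / 3 ^+ k <= (3 ^+ k)^-1 by rewrite ger_pMl// invr_gt0.
    lra.
  have x0 : 0 <= beta + lam * a by lra.
  have tay := @power_gap_taylor R m n _ _ X (ltnW ltnm) x0 e0 eX X1.
  apply: le_trans (cos_lipschitz _ _ _) _.
  have -> : 2 * pi * h%:R *
       ((beta + lam * (a + c / 3 ^+ k)) ^+ m - (beta + lam * (a + c / 3 ^+ k)) ^+ n) -
     (phi a + 2 * pi * xi a * c) =
     2 * pi * h%:R *
      (((beta + lam * a + lam * c / 3 ^+ k) ^+ m - (beta + lam * a + lam * c / 3 ^+ k) ^+ n) -
      ((beta + lam * a) ^+ m - (beta + lam * a) ^+ n +
       power_gap_deriv R m n (beta + lam * a) * (lam * c / 3 ^+ k))).
    rewrite /phi /xi.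
    have -> : beta + lam * (a + c / 3 ^+ k) = beta + lam * a + lam * c / 3 ^+ k by ring.
    by ring.
  rewrite normrM ger0_norm ?mulr_ge0 ?pi_ge0 ?ler0n//.
  apply: le_trans (ler_wpM2l _ tay) _; first by rewrite ?mulr_ge0 ?pi_ge0 ?ler0n.
  rewrite -[leLHS]mulrA ler_wpM2l ?mulr_ge0 ?pi_ge0//.
  have e9 : (lam * c / 3 ^+ k) ^+ 2 <= (9 ^+ k)^-1.
    rewrite expr_div_n p9 -expr2 ler_pdivrMr ?exprn_gt0// mulVf ?gt_eqF ?exprn_gt0//.
    rewrite exprn_ile1 ?mulr_ge0//; first exact: ltW.
    by rewrite mulr_ile1// ltW.
  apply: (@le_trans _ _ (h%:R * (m%:R ^+ 2 * X ^+ m * (9 ^+ k)^-1))).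
    rewrite ler_wpM2l ?ler0n// ler_wpM2l// mulr_ge0 ?sqr_ge0 ?exprn_ge0//.
  have -> : h%:R * (m%:R ^+ 2 * X ^+ m * (9 ^+ k)^-1) =
            h%:R * m%:R ^+ 2 * X ^+ m / 9 ^+ k by ring.
  by rewrite ler_pdivrMr// [leRHS]mulrC ler_pdivlMr.
have -> : S = (S - S') + S' by ring.
apply: le_trans (ler_normD _ _) _.
apply: le_trans (lerD dist lin) _.
rewrite -mulrDr ler_wpM2l ?exprn_ge0//.
(* (3/4)^8 < 1/9, so (3/4)^k is at most w^(-4m) *)
have pow34 : (3 / 4 : R) ^+ k <= (w ^+ m ^+ 4)^-1.
  rewrite -(@ler_pXn2r _ 8%N) ?nnegrE ?exprn_ge0 ?invr_ge0 ?exprn_ge0// ?(ltW wm0)//; last lra.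
  apply: (@le_trans _ _ (9 ^+ k)^-1).
    by rewrite -exprM mulnC exprM -exprVn; apply: lerXn2r; rewrite ?nnegrE; lra.
  rewrite exprVn lef_pV2 ?posrE ?exprn_gt0//; last by lra.
  rewrite -!exprM -mulnA mulnC exprM.
  apply: le_trans (lerXn2r m _ _ wb) _; rewrite ?nnegrE ?exprn_ge0//; try lra.
  apply: le_trans Yk; apply: (@le_trans _ _ (1 * X ^+ m * 1)).
    by rewrite mul1r mulr1 lerXn2r ?nnegrE// /X; lra.
  rewrite ler_pM ?mul1r ?exprn_ge0//; last exact: ltW.
  by rewrite ler_peMl ?exprn_ge0// mulr_ege1.
have Lub : L%:R <= (9 * beta ^+ 2 / lam ^+ 2 + 1) * m%:R ^+ 2 * w ^+ m ^+ 2.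
  have -> : (9 * beta ^+ 2 / lam ^+ 2 + 1) * m%:R ^+ 2 * w ^+ m ^+ 2 =
    9 * beta ^+ 2 * m%:R ^+ 2 * w ^+ m ^+ 2 / lam ^+ 2 + m%:R ^+ 2 * w ^+ m ^+ 2.
    by ring.
  rewrite /L -[(_.+1)%:R]natr1 lerD//.
    rewrite truncn_le; apply: divr_ge0; last exact: sqr_ge0.
    apply: mulr_ge0; last exact: sqr_ge0.
    by apply: mulr_ge0; last exact: sqr_ge0; rewrite mulr_ge0 ?sqr_ge0.
  by apply: mulr_ege1 => //; rewrite exprn_ege1// ltW.
have E0 : 0 <= expR (4 * pi) :> R by rewrite expR_ge0.
have last_term : L%:R * (3 / 4) ^+ k * expR (4 * pi) / (w ^+ m)^-1 <=
   (9 * beta ^+ 2 / lam ^+ 2 + 1) * expR (4 * pi) * m%:R ^+ 2 / w ^+ m.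
  rewrite invrK.
  apply: (@le_trans _ _ ((9 * beta ^+ 2 / lam ^+ 2 + 1) * m%:R ^+ 2 * w ^+ m ^+ 2 *
     (w ^+ m ^+ 4)^-1 * expR (4 * pi) * w ^+ m)).
    rewrite ler_wpM2r ?(ltW wm0)// ler_wpM2r// ler_pM ?ler0n ?exprn_ge0//; lra.
  by rewrite le_eqVlt; apply/orP; left; apply/eqP; field; rewrite (gt_eqF l0) (gt_eqF wm0).
apply: le_trans (lerD (lexx _) (lerD (lexx _) last_term)) _.
have iw0 : 0 < (w ^+ m)^-1 by rewrite invr_gt0.
have e1 : (w ^+ m)^-1 <= m%:R ^+ 2 / w ^+ m by rewrite ler_peMl ?(ltW iw0).
have e2 : 2 * pi / w ^+ m <= 2 * pi * (m%:R ^+ 2 / w ^+ m).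
  by rewrite ler_wpM2l ?mulr_ge0 ?pi_ge0.
have -> : (2 * pi + 1 + (9 * beta ^+ 2 / lam ^+ 2 + 1) * expR (4 * pi)) *
   m%:R ^+ 2 / w ^+ m = 2 * pi * (m%:R ^+ 2 / w ^+ m) + (m%:R ^+ 2 / w ^+ m +
   (9 * beta ^+ 2 / lam ^+ 2 + 1) * expR (4 * pi) * m%:R ^+ 2 / w ^+ m) by ring.
by rewrite lerD// lerD.
Qed.

(** * The mean square of the Weyl sums *)

(** The squared modulus of the exponential sum. *)
Definition weyl_sqr (R : realType) (h : nat) (x : nat -> R) (N : nat) : R :=
  (\sum_(1 <= n < N.+1) cos (2 * pi * h%:R * x n)) ^+ 2 +
  (\sum_(1 <= n < N.+1) sin (2 * pi * h%:R * x n)) ^+ 2.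

Lemma weyl_sqrS (R : realType) (h : nat) (x : nat -> R) (N : nat) :
  weyl_sqr R h x N.+1 = weyl_sqr R h x N + 1 +
    2 * \sum_(1 <= n < N.+1) cos (2 * pi * h%:R * (x N.+1 - x n)).
Proof.
rewrite /weyl_sqr (big_nat_recr N.+1)// (big_nat_recr N.+1)//=.
have -> : \sum_(1 <= n < N.+1) cos (2 * pi * h%:R * (x N.+1 - x n)) =
  cos (2 * pi * h%:R * x N.+1) * \sum_(1 <= n < N.+1) cos (2 * pi * h%:R * x n) +
  sin (2 * pi * h%:R * x N.+1) * \sum_(1 <= n < N.+1) sin (2 * pi * h%:R * x n).
  rewrite !mulr_sumr -big_split /=; apply: eq_bigr => n _.
  by rewrite mulrBr cosB.
have := cos2Dsin2 (2 * pi * h%:R * x N.+1).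
set C := cos _; set S := sin _; set A := \sum_(_ <= _ < _) _.
by set B := \sum_(_ <= _ < _) _ => cs; nra.
Qed.

Lemma mulrn_sub1_le_expn (R : realType) (v : R) (n : nat) : 1 <= v ->
  n%:R * (v - 1) <= v ^+ n.
Proof.
move=> v1; elim: n => [|n IH]; first by rewrite mulr0n mul0r expr0.
have : 1 <= v ^+ n by rewrite exprn_ege1.
rewrite -natr1 exprS; nra.
Qed.

Lemma cube_le_expn (R : realType) (v : R) (n : nat) : 1 < v ->
  n%:R ^+ 3 / v ^+ 3 ^+ n <= ((v - 1) ^+ 3)^-1.
Proof.
move=> v1.
rewrite ler_pdivrMr ?exprn_gt0//; try lra.
rewrite mulrC ler_pdivlMr ?exprn_gt0//; try lra.
rewrite -exprMn -exprM mulnC exprM lerXn2r ?nnegrE ?exprn_ge0//; try lra.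
  by rewrite mulr_ge0 ?ler0n; lra.
by apply: mulrn_sub1_le_expn; lra.
Qed.

(** By [weyl_sqrS], passing from N to N + 1 adds the diagonal term 1 and the
    N correlations of x^(N+1) with smaller powers, whose means are bounded by a
    multiple of N^2 w^-N with w = v^3. Taking w to be a cube makes N^3 w^-N
    bounded by Bernoulli's inequality. *)
Lemma mean_weyl_sqr (R : realType) (beta lam v : R) (h : nat) :
  1 < beta -> 0 < lam -> lam <= 1 -> 1 < v -> v ^+ 96 <= beta ->
  beta + lam <= beta * v ^+ 3 -> (0 < h)%N ->
  exists2 C : R, 0 <= C & forall N, exists K0, forall K, (K0 <= K)%N ->
    \sum_(c <- cantor_points R K) weyl_sqr R h (fun n => (beta + lam * c) ^+ n) N <=
    2 ^+ K * (C * N%:R).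
Proof.
move=> b1 l0 l1 v1 vb bv h0.
pose C0 := 2 * pi + 1 + (9 * beta ^+ 2 / lam ^+ 2 + 1) * expR (4 * pi).
have C00 : 0 <= C0.
  have e0 := expR_ge0 (4 * pi : R); have p0 := pi_ge0 R.
  have q0 : 0 <= 9 * beta ^+ 2 / lam ^+ 2.
    by apply: divr_ge0; [apply: mulr_ge0|]; rewrite ?sqr_ge0.
  rewrite /C0; nra.
have w1 : 1 < v ^+ 3 by rewrite exprn_egt1.
have wb : (v ^+ 3) ^+ 32 <= beta by rewrite -exprM.
exists (1 + 2 * (C0 / (v - 1) ^+ 3)).
  by rewrite addr_ge0// mulr_ge0// divr_ge0// exprn_ge0//; lra.
elim => [|N [K1 IH]].
  exists 0%N => K _; rewrite big1 ?mulr0 ?mulr0// => c _.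
  by rewrite /weyl_sqr !big_geq// expr0n addr0.
pose Y := h%:R * N.+1%:R ^+ 2 * (beta + lam) ^+ N.+1 * v ^+ 3 ^+ N.+1.
have Y1 : 1 <= Y.
  have h1 : 1 <= h%:R :> R by rewrite ler1n.
  have h2 : 1 <= N.+1%:R ^+ 2 :> R by rewrite exprn_ege1// ler1n.
  have h3 : 1 <= (beta + lam) ^+ N.+1 by rewrite exprn_ege1//; lra.
  have h4 : 1 <= v ^+ 3 ^+ N.+1 by rewrite exprn_ege1//; lra.
  by do 3 apply: mulr_ege1 => //.
have [k /andP[Yk kY]] := @exists_pow9 R Y Y1.
exists (maxn K1 (k + k)) => K; rewrite geq_max => /andP[K1K kK].
under eq_bigr => c _ do rewrite weyl_sqrS.
rewrite big_split /= big_split /= -mulr_sumr exchange_big /=.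
rewrite big_const_seq count_predT iter_addr_0 size_cantor_points natrX.
have step n : (0 < n < N.+1)%N -> \sum_(c <- cantor_points R K)
    cos (2 * pi * h%:R * ((beta + lam * c) ^+ N.+1 - (beta + lam * c) ^+ n)) <=
    2 ^+ K * (C0 * N.+1%:R ^+ 2 / v ^+ 3 ^+ N.+1).
  move=> nN; apply: le_trans (ler_norm _) _.
  have KE : K = (k + (k + (K - (k + k))))%N by rewrite addnA subnKC.
  by rewrite KE; apply: sum_cos_power_gap.
have tot : \sum_(1 <= n < N.+1) \sum_(c <- cantor_points R K)
    cos (2 * pi * h%:R * ((beta + lam * c) ^+ N.+1 - (beta + lam * c) ^+ n)) <=
    2 ^+ K * (C0 / (v - 1) ^+ 3).
  apply: (@le_trans _ _ (\sum_(1 <= n < N.+1)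
     2 ^+ K * (C0 * N.+1%:R ^+ 2 / v ^+ 3 ^+ N.+1))).
    by rewrite !big_nat; apply: ler_sum => n nN; exact: step.
  rewrite big_const_nat iter_addr_0 subn1 /= -(mulr_natr (_ * _)) -[leLHS]mulrA.
  rewrite ler_wpM2l ?exprn_ge0//.
  have -> : C0 * N.+1%:R ^+ 2 / v ^+ 3 ^+ N.+1 * N%:R =
            C0 * (N.+1%:R ^+ 2 * N%:R / v ^+ 3 ^+ N.+1) by ring.
  rewrite ler_wpM2l//; apply: le_trans (@cube_le_expn R v N.+1 v1).
  rewrite ler_wpM2r ?invr_ge0 ?exprn_ge0//; try lra.
  by rewrite [leRHS]exprSr ler_wpM2l ?sqr_ge0// ler_nat.
have := IH K K1K; rewrite -(natr1 N); move: tot.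
set D := C0 / _; set T := \sum_(1 <= _ < _) _; set W := \sum_(_ <- _) _.
by move=> *; lra.
Qed.

(** * Weyl's criterion *)

(** Q times the Fejer kernel of order Q. *)
Definition fejer (R : realType) (Q : nat) (z : R) : R :=
  (\sum_(j < Q) cos (2 * pi * z * j%:R)) ^+ 2 +
  (\sum_(j < Q) sin (2 * pi * z * j%:R)) ^+ 2.

Lemma fejer_ge0 (R : realType) (Q : nat) (z : R) : 0 <= fejer R Q z.
Proof. by rewrite addr_ge0// sqr_ge0. Qed.

Lemma fejerE (R : realType) (Q : nat) (z : R) :
  fejer R Q z = \sum_(i < Q) \sum_(j < Q) cos (2 * pi * z * (i%:R - j%:R)).
Proof.
rewrite /fejer !expr2 !mulr_suml -big_split /=; apply: eq_bigr => i _.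
rewrite !mulr_sumr -big_split /=; apply: eq_bigr => j _.
by rewrite mulrBr cosB.
Qed.

Lemma fejer_sin (R : realType) (Q : nat) (z : R) :
  fejer R Q z * sin (pi * z) ^+ 2 <= 2.
Proof.
have e : 2 * pi * z / 2 = pi * z by field.
have h phi : (sin (pi * z) * \sum_(j < Q) cos (phi + 2 * pi * z * j%:R)) ^+ 2 <= 1.
  have := sum_cos_arith R phi (2 * pi * z) Q; rewrite e.
  have := sin_le1 (phi + 2 * pi * z * Q%:R - pi * z).
  have := sin_geN1 (phi + 2 * pi * z * Q%:R - pi * z).
  have := sin_le1 (phi - pi * z); have := sin_geN1 (phi - pi * z).
  set S := \sum_(_ < _) _; set s := sin (pi * z); set a := sin (phi - _).
  set b := sin _ => *; rewrite expr2.
  have : s * S <= 1 by lra.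
  have : -1 <= s * S by lra.
  nra.
have := h 0; have := h (- (pi / 2)).
under eq_bigr => j _ do rewrite addrC cosBpihalf.
under [in X in _ -> X -> _]eq_bigr do rewrite add0r.
rewrite /fejer !exprMn; lra.
Qed.

(** The frequencies that occur in the kernel are smaller than Q in absolute
    value, so sampling at Q equally spaced points integrates the kernel
    exactly. *)
Lemma fejer_mean (R : realType) (Q : nat) (z : R) :
  \sum_(q < Q) fejer R Q (z + q%:R / Q%:R) = Q%:R ^+ 2.
Proof.
under eq_bigr => q _ do rewrite fejerE.
have -> : Q%:R ^+ 2 = \sum_(i < Q) Q%:R :> R.
  by rewrite sumr_const card_ord expr2 mulr_natr.
rewrite exchange_big /=.
apply: eq_bigr => i _; rewrite exchange_big /= (bigD1 i)//=.
rewrite [X in _ + X]big1 => [|j ji].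
  under eq_bigr => q _ do rewrite subrr mulr0 cos0.
  by rewrite sumr_const card_ord addr0.
have off (a b : 'I_Q) : (b < a)%N ->
    \sum_(q < Q) cos (2 * pi * (z + q%:R / Q%:R) * (a%:R - b%:R)) = 0 :> R.
  move=> ba; rewrite -natrB 1?ltnW//.
  rewrite -[RHS](@sum_cos_roots R (2 * pi * z * (a - b)%:R) (a - b) Q).
    by apply: eq_bigr => q _; congr cos; ring.
  by rewrite subn_gt0 ba (leq_ltn_trans (leq_subr _ _) (ltn_ord a)).
have [lij|lji|eij] := ltngtP j i; [exact: off| |]; last first.
  by move: ji; rewrite -val_eqE /= eij eqxx.
rewrite -[RHS](off _ _ lji); apply: eq_bigr => q _.
by rewrite -(opprB j%:R) mulrN cosN.
Qed.

(** The indicator function of [u, v] is bounded above by a trigonometric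
    polynomial P plus a small constant: P is the mean of the normalised kernel
    over those of the Q sample points that lie, up to delta, in [u, v], and for
    a point of [u, v] the other samples are at distance at least delta modulo
    one, where the kernel is small. The mean of P along the sequence tends to
    its constant term, the proportion of the sample points used. *)
Lemma count_le_of_weyl (R : realType) (y : nat -> R) (u v eps : R) :
  (forall h : nat, (0 < h)%N -> forall e : R, 0 < e -> exists N0, forall N, (N0 <= N)%N ->
     forall alpha, \sum_(1 <= n < N.+1) cos (2 * pi * h%:R * y n - alpha) <= e * N%:R) ->
  (forall n, 0 <= y n <= 1) -> 0 <= u -> u <= v -> v <= 1 -> 0 < eps ->
  exists N0, forall N, (N0 <= N)%N ->
    (count (fun n => u <= y n <= v) (iota 1 N))%:R <= (v - u + eps) * N%:R.
Proof.
move=> weyl y01 u0 uv v1 eps0.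
pose delta := eps / (16 * (1 + eps)).
have eps1 : 0 < 1 + eps by lra.
have d0 : 0 < delta by rewrite divr_gt0//; lra.
have d1 : delta < 16^-1.
  by rewrite /delta invfM mulrA ltr_pdivrMr// mulrC ltr_pM2l//; lra.
have d2 : delta <= eps / 16.
  by rewrite /delta invfM mulrA ler_pdivrMr// ler_peMr//; lra.
pose s0 := sin (pi * delta) ^+ 2.
have sd0 : 0 < sin (pi * delta).
  by apply: sin_gt0_pi; rewrite mulr_gt0 ?pi_gt0//= gtr_pMr ?pi_gt0//; lra.
have s00 : 0 < s0 by rewrite exprn_gt0.
pose Q := (Num.truncn (4 / eps + 8 / (eps * s0))).+1.
have Q0 : 0 < Q%:R :> R by rewrite ltr0n.
have QB : 4 / eps + 8 / (eps * s0) < Q%:R by exact: truncnS_gt.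
have es0 : 0 < eps * s0 by rewrite mulr_gt0.
have Q1 : Q%:R^-1 <= eps / 4.
  rewrite -[eps / 4]invrK lef_pV2 ?posrE ?invr_gt0 ?divr_gt0// invf_div.
  by apply/ltW/(le_lt_trans _ QB); rewrite lerDl divr_ge0// ltW.
have Q2 : 2 / (Q%:R * s0) <= eps / 4.
  rewrite ler_pdivrMr ?mulr_gt0//.
  have : 8 / (eps * s0) < Q%:R.
    by apply: le_lt_trans QB; rewrite lerDr divr_ge0// ltW.
  by rewrite ltr_pdivrMr// => ?; lra.
(* The sample points start at u - delta; the first nn of them cover
   [u - delta, v + delta]. *)
pose nn := (Num.truncn (Q%:R * (v - u + 2 * delta))).+1.
pose n' := minn nn Q.
pose z n := u - delta - y n.
pose P n := \sum_(0 <= q < n') fejer R Q (z n + q%:R / Q%:R).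
have P0 n : 0 <= P n by rewrite sumr_ge0// => q _; exact: fejer_ge0.
have far n : u <= y n <= v -> 1 <= P n / Q%:R ^+ 2 + eps / 4.
  move=> /andP[uy yv].
  have : Q%:R ^+ 2 <= P n + Q%:R * (2 / s0).
    rewrite -(fejer_mean R Q (z n)).
    rewrite -(big_mkord xpredT (fun q => fejer R Q (z n + q%:R / Q%:R))).
    rewrite (@big_cat_nat _ _ _ n') ?geq_minr//= lerD2l.
    apply: (@le_trans _ _ (\sum_(n' <= q < Q) 2 / s0)); last first.
      rewrite big_const_nat iter_addr_0 -(mulr_natl (2 / s0)) ler_wpM2r//.
        by rewrite divr_ge0// ltW.
      by rewrite ler_nat leq_subr.
    rewrite !big_nat; apply: ler_sum => q /andP[nq qQ].
    have nnq : (nn <= q)%N by move: nq; rewrite /n' geq_min (leqNgt Q) qQ orbF.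
    rewrite ler_pdivlMr//; apply: le_trans (@fejer_sin R Q (z n + q%:R / Q%:R)).
    rewrite ler_wpM2l ?fejer_ge0//.
    have q1 : v - u + 2 * delta <= q%:R / Q%:R.
      rewrite ler_pdivlMr// mulrC; apply/ltW/(lt_le_trans (truncnS_gt _)).
      by rewrite ler_nat.
    have q2 : q%:R / Q%:R <= 1 :> R.
      by rewrite ler_pdivrMr// mul1r ler_nat ltnW.
    have b1 : delta <= z n + q%:R / Q%:R by rewrite /z; lra.
    have b2 : z n + q%:R / Q%:R <= 1 - delta by rewrite /z; lra.
    have pp := pi_gt0 R.
    move: b1 b2; set t := z n + _ => b1 b2.
    have st : sin (pi * delta) <= sin (pi * t).
      have e1 : pi * t = pi * (t + delta) / 2 + pi * (t - delta) / 2 by field.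
      have e2 : pi * delta = pi * (t + delta) / 2 - pi * (t - delta) / 2 by field.
      have c0 : 0 <= cos (pi * (t + delta) / 2).
        by apply: cos_ge0_pihalf; apply/andP; split; nra.
      have sn0 : 0 <= sin (pi * (t - delta) / 2).
        by apply: sin_ge0_pi; apply/andP; split; nra.
      rewrite e1 e2 sinB sinD; nra.
    by rewrite lerXn2r ?nnegrE ?(ltW sd0)// (le_trans _ st)// ltW.
  rewrite -(ler_pM2r (_ : 0 < (Q%:R ^+ 2)^-1)) ?invr_gt0 ?exprn_gt0//.
  rewrite mulfV ?expf_neq0 ?gt_eqF// mulrDl.
  have -> : Q%:R * (2 / s0) / Q%:R ^+ 2 = 2 / (Q%:R * s0).
    by field; rewrite !gt_eqF.
  lra.
pose e := eps / (4 * nn%:R).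
have nn0 : 0 < nn%:R :> R by rewrite ltr0n.
have e0 : 0 < e by rewrite divr_gt0// mulr_gt0.
have [f fP] := choice (fun h : nat => weyl h.+1 isT e e0).
exists (\max_(h < Q) f h) => N NN.
have off (c : R) (i j : 'I_Q) : i != j ->
    \sum_(1 <= n < N.+1) cos (2 * pi * (c - y n) * (i%:R - j%:R)) <= e * N%:R.
  have main (a b : 'I_Q) : (b < a)%N ->
      \sum_(1 <= n < N.+1) cos (2 * pi * (c - y n) * (a%:R - b%:R)) <= e * N%:R.
    move=> ba; have aQ : ((a - b).-1 < Q)%N.
      by rewrite (leq_ltn_trans (leq_pred _))// (leq_ltn_trans (leq_subr _ _)).
    have NN' : (f (a - b).-1 <= N)%N.
      exact: leq_trans (leq_bigmax (Ordinal aQ)) NN.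
    apply: le_trans (fP _ _ NN' (2 * pi * c * (a - b)%:R)).
    rewrite prednK ?subn_gt0// le_eqVlt; apply/orP; left; apply/eqP.
    apply: eq_bigr => n _; rewrite -natrB 1?ltnW// -[LHS]cosN; congr cos; ring.
  have [lij|lji|eij] := ltngtP j i; first by move=> _; exact: main.
    move=> _; apply: le_trans (main _ _ lji).
    rewrite le_eqVlt; apply/orP; left; apply/eqP; apply: eq_bigr => n _.
    by rewrite -(opprB j%:R) mulrN cosN.
  by rewrite -val_eqE /= eij eqxx.
have eN : 0 <= e * N%:R by apply: mulr_ge0; [exact: ltW|exact: ler0n].
have sumP : \sum_(1 <= n < N.+1) P n <= nn%:R * (Q%:R * N%:R + Q%:R ^+ 2 * (e * N%:R)).
  rewrite exchange_big /=.
  apply: (@le_trans _ _ (\sum_(0 <= q < n') (Q%:R * N%:R + Q%:R ^+ 2 * (e * N%:R)))).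
    apply: ler_sum => q _.
    under eq_bigr => n _ do rewrite fejerE.
    rewrite exchange_big /=.
    apply: (@le_trans _ _ (\sum_(i < Q) (N%:R + Q%:R * (e * N%:R)))); last first.
      by rewrite sumr_const card_ord -mulr_natl; lra.
    apply: ler_sum => i _; rewrite exchange_big /= (bigD1 i)//= lerD//.
      under eq_bigr => n _ do rewrite subrr mulr0 cos0.
      by rewrite big_const_nat iter_addr_0 subn1.
    apply: (@le_trans _ _ (\sum_(j < Q | j != i) e * N%:R)).
      apply: ler_sum => j ji; rewrite /z.
      apply: le_trans (off (u - delta + q%:R / Q%:R) i j _); last by rewrite eq_sym.
      rewrite le_eqVlt; apply/orP; left; apply/eqP; apply: eq_bigr => n _.
      congr cos; ring.
    rewrite sumr_const -[leLHS]mulr_natl ler_wpM2r//.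
    by rewrite ler_nat -[leqRHS](card_ord Q) max_card.
  rewrite big_const_nat iter_addr_0 subn0 -[leLHS]mulr_natl ler_wpM2r//.
    by apply: addr_ge0; apply: mulr_ge0; rewrite ?ler0n ?sqr_ge0.
  by rewrite ler_nat geq_minl.
have nnB : nn%:R <= Q%:R * (v - u + 2 * delta) + 1.
  by rewrite /nn -[(_.+1)%:R]natr1 lerD2r truncn_le mulr_ge0 ?ler0n//; lra.
apply: (@le_trans _ _ (\sum_(1 <= n < N.+1) (P n / Q%:R ^+ 2 + eps / 4))).
  rewrite -sum1_count natr_sum big_mkcond /= /index_iota subn1.
  apply: ler_sum => n _; case: ifP => [/far//|_].
  by rewrite addr_ge0 ?divr_ge0 ?sqr_ge0// ltW.
rewrite big_split /= -mulr_suml big_const_nat iter_addr_0 subn1 /= -(mulr_natl (eps / 4)).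
have -> : (v - u + eps) * N%:R = (v - u + eps - eps / 4) * N%:R + N%:R * (eps / 4) by ring.
rewrite lerD2r ler_pdivrMr ?exprn_gt0//; apply: le_trans sumP _.
have -> : nn%:R * (Q%:R * N%:R + Q%:R ^+ 2 * (e * N%:R)) =
   (nn%:R / Q%:R + nn%:R * e) * N%:R * Q%:R ^+ 2 by field; rewrite gt_eqF.
rewrite ler_wpM2r ?sqr_ge0// ler_wpM2r ?ler0n//.
have -> : nn%:R * e = eps / 4 by rewrite /e; field; rewrite gt_eqF.
have : nn%:R / Q%:R <= v - u + 2 * delta + Q%:R^-1.
  rewrite ler_pdivrMr// mulrDl mulVf ?gt_eqF//; lra.
lra.
Qed.

Lemma cosDz2pi (R : realType) (x : R) (z : int) : cos (x + 2 * pi * z%:~R) = cos x.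
Proof.
case: z => n; first exact: cosDn2pi.
by rewrite NegzE mulrNz mulrN -[LHS](cosDn2pi _ _ n.+1) subrK.
Qed.

Lemma frac_part_itv (R : realType) (x : R) : 0 <= frac_part x <= 1.
Proof.
rewrite /frac_part subr_ge0 floor_le /= lerBlDl addrC.
have := floorD1_gt x; rewrite intrD; lra.
Qed.

Lemma exists_sqrtn (N : nat) : exists k, (k ^ 2 <= N < k.+1 ^ 2)%N.
Proof.
elim: N => [|N [k /andP[kN Nk]]]; first by exists 0%N.
have [h|h] := ltnP N.+1 (k.+1 ^ 2); first by exists k; rewrite h (leq_trans kN).
exists k.+1; rewrite h /= (leq_ltn_trans Nk)//.
by rewrite ltn_exp2r.
Qed.

(** An arbitrary N lies between consecutive squares k^2 and (k+1)^2, and the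
    terms of index larger than k^2 contribute at most 2 k. The modulus controls
    all phase shifts alpha uniformly. *)
Lemma phase_sum_small (R : realType) (h : nat) (x : nat -> R) :
  (forall i : nat, exists k0, forall k, (k0 <= k)%N ->
     i.+1%:R * weyl_sqr R h x (k ^ 2) < k%:R ^+ 4) ->
  forall e : R, 0 < e -> exists N0, forall N, (N0 <= N)%N ->
    forall alpha, \sum_(1 <= n < N.+1) cos (2 * pi * h%:R * x n - alpha) <= e * N%:R.
Proof.
move=> small e e0.
pose i := Num.truncn (16 / e ^+ 2).
have iP : 16 < i.+1%:R * e ^+ 2.
  by rewrite -ltr_pdivrMr ?exprn_gt0//; exact: truncnS_gt.
have [k0 k0P] := small i.
pose k1 := (Num.truncn (4 / e)).+1.
have k1P : 4 < k1%:R * e by rewrite -ltr_pdivrMr//; exact: truncnS_gt.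
exists ((maxn k0 k1) ^ 2)%N => N NN alpha.
have [k /andP[kN Nk]] := exists_sqrtn N.
have : (maxn k0 k1 <= k)%N by rewrite -ltnS -(@ltn_exp2r _ _ 2)// (leq_ltn_trans NN).
rewrite geq_max => /andP[k0k k1k].
have kR : k1%:R <= k%:R :> R by rewrite ler_nat.
have k_ge0 : 0 <= k%:R :> R by rewrite ler0n.
rewrite (@big_cat_nat _ _ _ (k ^ 2).+1)//=.
have tail : \sum_((k ^ 2).+1 <= n < N.+1) cos (2 * pi * h%:R * x n - alpha) <= 2 * k%:R.
  apply: (@le_trans _ _ (\sum_((k ^ 2).+1 <= n < N.+1) 1)).
    by apply: ler_sum => n _; exact: cos_le1.
  rewrite big_const_nat iter_addr_0 subSS -[2 * _]natrM ler_nat leq_subLR.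
  by move: Nk; rewrite -(addn1 k) sqrnD muln1 exp1n addnAC addn1 ltnS.
have NR : k%:R ^+ 2 <= N%:R :> R by rewrite -natrX ler_nat.
have := k0P k k0k; rewrite /weyl_sqr.
have -> : \sum_(1 <= n < (k ^ 2).+1) cos (2 * pi * h%:R * x n - alpha) =
  cos alpha * \sum_(1 <= n < (k ^ 2).+1) cos (2 * pi * h%:R * x n) +
  sin alpha * \sum_(1 <= n < (k ^ 2).+1) sin (2 * pi * h%:R * x n).
  rewrite !mulr_sumr -big_split /=; apply: eq_bigr => n _.
  by rewrite cosB mulrC (mulrC (sin _)).
set A := \sum_(_ <= _ < _) _; set B := \sum_(_ <= _ < _) _ => AB.
have aux (C : R) : i.+1%:R * C ^+ 2 < k%:R ^+ 4 -> `|C| <= e / 4 * k%:R ^+ 2.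
  move=> hC; have ek0 : 0 <= e / 4 * k%:R ^+ 2 by rewrite mulr_ge0 ?sqr_ge0//; lra.
  rewrite -(@ler_pXn2r _ 2) ?nnegrE// real_normK ?num_real//.
  have C2 : 0 <= C ^+ 2 by rewrite sqr_ge0.
  have -> : (e / 4 * k%:R ^+ 2) ^+ 2 = e ^+ 2 * k%:R ^+ 4 / 16 by field.
  have : e ^+ 2 * (i.+1%:R * C ^+ 2) <= e ^+ 2 * k%:R ^+ 4.
    by rewrite ler_wpM2l ?sqr_ge0// ltW.
  have : 16 * C ^+ 2 <= i.+1%:R * e ^+ 2 * C ^+ 2 by rewrite ler_wpM2r// ltW.
  lra.
have i0 : 0 < i.+1%:R :> R by rewrite ltr0n.
have A2 : `|A| <= e / 4 * k%:R ^+ 2.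
  apply: aux; apply: le_lt_trans AB.
  by rewrite ler_wpM2l ?(ltW i0)// lerDl sqr_ge0.
have B2 : `|B| <= e / 4 * k%:R ^+ 2.
  apply: aux; apply: le_lt_trans AB.
  by rewrite ler_wpM2l ?(ltW i0)// lerDr sqr_ge0.
have cA : cos alpha * A <= `|A|.
  apply: le_trans (ler_norm _) _; rewrite normrM ler_piMl//; exact: cos_max.
have sB : sin alpha * B <= `|B|.
  apply: le_trans (ler_norm _) _; rewrite normrM ler_piMl//; exact: sin_max.
have : 2 * k%:R <= e / 2 * k%:R ^+ 2.
  have : 4 * k%:R <= k1%:R * e * k%:R by rewrite ler_wpM2r// ltW.
  have : k1%:R * (e * k%:R) <= k%:R * (e * k%:R).
    by rewrite ler_wpM2r// mulr_ge0// ltW.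
  rewrite expr2; lra.
have : e * k%:R ^+ 2 <= e * N%:R by rewrite ler_wpM2l// ltW.
lra.
Qed.

(** The lower bound for [u, v] follows from the upper bounds for the
    complementary intervals [0, u] and [v, 1], so upper bounds suffice. *)
Lemma uniformly_distributed_of_weyl (R : realType) (x : nat -> R) :
  (forall h : nat, (0 < h)%N -> forall i : nat, exists k0, forall k, (k0 <= k)%N ->
     i.+1%:R * weyl_sqr R h x (k ^ 2) < k%:R ^+ 4) ->
  uniformly_distributed_mod1 x.
Proof.
move=> small u v u0 uv v1.
pose y n := frac_part (x n).
have weyl (h : nat) : (0 < h)%N -> forall e : R, 0 < e ->
   exists N0, forall N, (N0 <= N)%N -> forall alpha,
     \sum_(1 <= n < N.+1) cos (2 * pi * h%:R * y n - alpha) <= e * N%:R.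
  move=> h0 e e0; have [N0 N0P] := @phase_sum_small R h x (small h h0) e e0.
  exists N0 => N NN alpha; apply: le_trans (N0P N NN alpha).
  rewrite le_eqVlt; apply/orP; left; apply/eqP; apply: eq_bigr => n _.
  rewrite -(cosDz2pi _ _ (h%:Z * Num.floor (x n))) intrM; congr cos.
  by rewrite /y /frac_part -pmulrn; ring.
have y01 n : 0 <= y n <= 1 by exact: frac_part_itv.
apply/cvgrPdist_le => eps eps0.
have eps2 : 0 < eps / 2 by lra.
have [N1 N1P] := @count_le_of_weyl R y u v _ weyl y01 u0 (ltW uv) v1 eps2.
have [N2 N2P] := @count_le_of_weyl R y 0 u _ weyl y01 (lexx _) u0 (ltW (lt_le_trans uv v1)) eps2.
have [N3 N3P] := @count_le_of_weyl R y v 1 _ weyl y01 (ltW (le_lt_trans u0 uv)) v1 (lexx _) eps2.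
exists (maxn (maxn N1 N2) (maxn N3 1)) => // N /=.
rewrite !geq_max => /andP[/andP[/N1P c1 /N2P c2] /andP[/N3P c3 N0]].
have NR : 0 < N%:R :> R by rewrite ltr0n.
pose pc (n : nat) := u <= y n <= v.
pose pl (n : nat) := 0 <= y n <= u.
pose pr (n : nat) := v <= y n <= 1.
rewrite -/pc -/pl -/pr in c1 c2 c3 *.
have countU (a b : pred nat) s : (count (predU a b) s <= count a s + count b s)%N.
  by rewrite -count_predUI leq_addr.
have tot : (N <= count pc (iota 1 N) +
                 (count pl (iota 1 N) + count pr (iota 1 N)))%N.
  apply: leq_trans (leq_add (leqnn _) (countU _ _ _)).
  apply: leq_trans (countU _ _ _).
  rewrite -{1}(size_iota 1 N) -(count_predT (iota 1 N)).
  apply: sub_count => n _ /=; rewrite /pc /pl /pr.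
  have /andP[y0 y1] := y01 n; rewrite y0 y1 /= andbT.
  by case: (leP u (y n)) => /= h1; case: (leP (y n) v) => //= h2; rewrite ?(ltW h1) ?(ltW h2) ?orbT.
move: tot; rewrite -(ler_nat R) !natrD => tot.
rewrite -/(y _) -/pc.
rewrite ler_norml; apply/andP; split.
  rewrite -(ler_pM2r NR) mulrBl divfK ?gt_eqF//; lra.
rewrite -(ler_pM2r NR) mulrBl divfK ?gt_eqF//; lra.
Qed.

(** * Null sets for the Hausdorff measure *)

Lemma hausdorff_gauge_ge0 (R : realType) (s : R) (U : set R) :
  (0 <= hausdorff_gauge s U)%E.
Proof. by rewrite /hausdorff_gauge; case: ifP => // _; exact: poweR_ge0. Qed.

Lemma hausdorff_delta_ge0 (R : realType) (s delta : R) (A : set R) :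
  (0 <= hausdorff_delta s delta A)%E.
Proof.
apply: le_ereal_inf_tmp => _ [U _ <-].
by apply: nneseries_ge0 => n _ _; exact: hausdorff_gauge_ge0.
Qed.

Lemma le_hausdorff_delta (R : realType) (s delta : R) (A B : set R) : A `<=` B ->
  (hausdorff_delta s delta A <= hausdorff_delta s delta B)%E.
Proof.
move=> AB; apply: ereal_inf_le_tmp => _ [U [BU dU] <-].
by exists U => //; split => //; exact: subset_trans BU.
Qed.

(** For each n choose a cover of A n that is optimal up to e / 2^(n+1), and
    enumerate the doubly indexed family through a bijection between nat and
    nat * nat. *)
Lemma hausdorff_delta_subadditive (R : realType) (s delta : R) :
  sigma_subadditive (hausdorff_delta s delta).
Proof.
move=> A; set H := hausdorff_delta s delta.
have [[i ioo]|] := pselect (exists i, H (A i) = +oo%E).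
  rewrite (eseries_pinfty _ _ ioo) ?leey// => n _.
  by rewrite -ltNye (lt_le_trans _ (hausdorff_delta_ge0 _ _ _ _)).
rewrite -forallNE => Aoo.
apply/lee_addgt0Pr => e e0.
apply: le_trans (epsilon_trick _ _ (ltW e0)); last first.
  by move=> n; exact: hausdorff_delta_ge0.
pose P n (B : (set R)^nat) := (A n `<=` \bigcup_k B k /\
    forall k, (diam (B k) <= delta%:E)%E) /\
  (\sum_(k <oo) hausdorff_gauge s (B k) <= H (A n) + (e / (2 ^ n.+1)%:R)%:E)%E.
have [G PG] : {G : ((set R)^nat)^nat & forall n, P n (G n)}.
  apply: (@choice _ _ P) => n; rewrite /P.
  have en : 0 < e / (2 ^ n.+1)%:R by rewrite divr_gt0// ltr0n expn_gt0.
  have fin : H (A n) \is a fin_num.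
    by rewrite ge0_fin_numE ?hausdorff_delta_ge0// ltey; exact/eqP/Aoo.
  have [_ [B [AB dB] <-] /ltW lt] := lb_ereal_inf_adherent en fin.
  by exists B.
pose mu := hausdorff_gauge s.
have muG_ge0 x : (0 <= (mu \o uncurry G) x)%E by exact: hausdorff_gauge_ge0.
apply: (@le_trans _ _ (\esum_(i in setT) (mu \o uncurry G) i)%E).
  apply: ereal_inf_lbound => /=.
  have /card_esym/ppcard_eqP[f] := card_nat2.
  exists (uncurry G \o f).
    split => [|n]; last by have := (PG (f n).1).1.2 (f n).2; rewrite /=; case: (f n).
    move=> t [i _] /(PG i).1.1 -[j _ Gij]; exists (f^-1%FUN (i, j)) => //=.
    by rewrite invK ?inE.
  rewrite -(esum_pred_image (mu \o uncurry G) _ xpredT) ?[fun=> _]set_true//.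
  by rewrite image_eq.
rewrite (_ : esum _ _ = \sum_(i <oo) \sum_(j <oo ) mu (G i j))%E; last first.
  pose J : nat -> set (nat * nat) := fun i => [set (i, j) | j in setT].
  rewrite (_ : setT = \bigcup_k J k); last first.
    by rewrite predeqE => -[a b]; split => // _; exists a => //; exists b.
  rewrite esum_bigcupT /=; last 2 first.
    - apply/trivIsetP => i j _ _ ij.
      rewrite predeqE => -[n m] /=; split => //= -[] [_] _ [<-{n} _].
      by move=> [m' _] [] /esym/eqP; rewrite (negbTE ij).
    - by move=> /= [n m]; exact: hausdorff_gauge_ge0.
  rewrite -(image_id [set: nat]) -fun_true esum_pred_image//; last first.
    by move=> n _; apply: esum_ge0 => x _; exact: muG_ge0.
  apply: eq_eseriesr => /= j _.
  rewrite -(esum_pred_image (mu \o uncurry G) (pair j) predT)//=; last first.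
    by move=> ? ? _ _; exact: (@can_inj _ _ _ snd).
    by move=> n _; exact: muG_ge0 (j, n).
  by congr esum; rewrite predeqE => -[a b]; split; move=> [i _ <-]; exists i.
apply: lee_nneseries => [n _ _|n _]; last exact: (PG n).2.
by apply: nneseries_ge0 => m _ _; exact: hausdorff_gauge_ge0.
Qed.

Lemma hausdorff_delta_bigcup0 (R : realType) (s delta : R) (A : nat -> set R) :
  (forall n, hausdorff_delta s delta (A n) = 0%E) ->
  hausdorff_delta s delta (\bigcup_n A n) = 0%E.
Proof.
move=> A0; apply/eqP; rewrite eq_le hausdorff_delta_ge0 andbT.
apply: le_trans (hausdorff_delta_subadditive _ _ _ _) _.
by rewrite eseries0// => n _ _.
Qed.

Lemma hausdorff_measure0 (R : realType) (s : R) (A : set R) :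
  (forall delta, 0 < delta -> hausdorff_delta s delta A = 0%E) ->
  hausdorff_measure s A = 0%E.
Proof.
move=> A0; apply/eqP; rewrite eq_le; apply/andP; split.
  by apply: ge_ereal_sup => _ [d d0 <-]; rewrite A0.
by apply: ereal_sup_ubound; exists 1; [exact: ltr01|exact: (A0 _ ltr01)].
Qed.

Lemma diam_itv_le (R : realType) (a r : R) (U : set R) :
  U `<=` [set x | a <= x <= a + r] -> (diam U <= r%:E)%E.
Proof.
move=> Ua; apply: ge_ereal_sup => _ [x /Ua /= /andP[x1 x2]] [y /Ua /= /andP[y1 y2]] <-.
by rewrite lee_fin ler_norml; apply/andP; split; lra.
Qed.

Lemma powR_third (R : realType) (k : nat) :
  ((3 ^+ k)^-1 : R) `^ (ln 2 / ln 3) = (2 ^+ k)^-1.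
Proof.
have l3 : 0 < ln 3 :> R by rewrite ln_gt0// ltr1n.
rewrite -[RHS]lnK ?posrE ?invr_gt0 ?exprn_gt0// /powR ifF; last first.
  by rewrite gt_eqF// invr_gt0 exprn_gt0.
rewrite !lnV ?posrE ?exprn_gt0// !lnXn// -(mulr_natl (ln 2)) -(mulr_natl (ln 3)).
congr expR.
by field; rewrite gt_eqF.
Qed.

Lemma hausdorff_gauge_itv (R : realType) (k : nat) (a r : R) (U : set R) :
  r <= (3 ^+ k)^-1 -> U `<=` [set x | a <= x <= a + r] ->
  (hausdorff_gauge (ln 2 / ln 3) U <= ((2 ^+ k)^-1)%:E)%E.
Proof.
move=> rk Ua; rewrite /hausdorff_gauge; case: eqP => [_|/eqP/set0P[x Ux]].
  by rewrite lee_fin invr_ge0 exprn_ge0.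
have k0 : 0 < (3 ^+ k)^-1 :> R by rewrite invr_gt0 exprn_gt0.
rewrite -powR_third -poweR_EFin.
have d0 : (0 <= diam U)%E.
  by apply: ereal_sup_ubound; exists x => //; exists x => //; rewrite subrr normr0.
apply: gt0_ler_poweR; rewrite ?in_itv /= ?leey ?andbT ?lee_fin ?(ltW k0)//.
  by rewrite divr_ge0// ln_ge0// ler1n.
by apply: le_trans (@diam_itv_le R a r U Ua) _; rewrite lee_fin.
Qed.

(** The finite cover is completed by empty sets, whose diameter -oo is below
    every delta. The sum is stated as a number of intervals divided by 2^k, the
    proportion of the intervals of stage k. *)
Lemma hausdorff_delta_finite_cover (R : realType) (delta r : R) (k : nat)
    (p : seq R) (A : set R) :
  r <= (3 ^+ k)^-1 -> r <= delta -> 0 < delta ->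
  A `<=` [set x | exists2 a, a \in p & a <= x <= a + r] ->
  (hausdorff_delta (ln 2 / ln 3) delta A <= ((size p)%:R / 2 ^+ k)%:E)%E.
Proof.
move=> rk rd d0 Ap.
pose U n := if (n < size p)%N then [set x | nth 0 p n <= x <= nth 0 p n + r] else set0.
apply: (@le_trans _ _ (\sum_(n <oo) hausdorff_gauge (ln 2 / ln 3) (U n))%E).
  apply: ereal_inf_lbound; exists U => //; split => [x /Ap[a ap ax]|n].
    by exists (index a p) => //; rewrite /U index_mem ap nth_index.
  rewrite /U; case: ifP => _.
    by apply: le_trans (@diam_itv_le R (nth 0 p n) r _ _) _ => //; rewrite lee_fin.
  by apply: le_trans (@diam_itv_le R 0 delta _ _) _.
rewrite (nneseries_split 0 (size p)) => [|n _]; last exact: hausdorff_gauge_ge0.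
rewrite add0n [X in (_ + X)%E]eseries0 => [|n pn _]; last first.
  by rewrite /U ltnNge pn /hausdorff_gauge eqxx.
rewrite adde0.
apply: (@le_trans _ _ (\sum_(0 <= n < size p) ((2 ^+ k)^-1)%:E)%E).
  rewrite !big_nat; apply: lee_sum => n /andP[_ np].
  apply: (@hausdorff_gauge_itv _ _ (nth 0 p n) r) => //.
  by rewrite /U np.
by rewrite sumEFin big_const_nat iter_addr_0 subn0 mulr_natl.
Qed.

Lemma sum_inv_sqr_le (R : realType) (k0 n : nat) : (0 < k0)%N ->
  \sum_(0 <= k < n) ((k0 + k)%:R ^+ 2)^-1 <= 2 / k0%:R - 2 / (k0 + n)%:R :> R.
Proof.
move=> k00; elim: n => [|n IH]; first by rewrite big_geq// addn0 subrr.
rewrite big_nat_recr//=; apply: le_trans (lerD IH (lexx _)) _.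
rewrite addnS -[(k0 + n).+1%:R]natr1; set m := (k0 + n)%:R.
have m1 : 1 <= m by rewrite ler1n addn_gt0 k00.
clearbody m.
have m0 : 0 < m by lra.
have m10 : 0 < m + 1 by lra.
have e : 2 / m - 2 / (m + 1) - (m ^+ 2)^-1 = (m - 1) / (m ^+ 2 * (m + 1)).
  by field; rewrite (gt_eqF m0) (gt_eqF m10).
have : 0 <= (m - 1) / (m ^+ 2 * (m + 1)).
  by rewrite divr_ge0 ?mulr_ge0 ?sqr_ge0//; lra.
lra.
Qed.

(** The tails of the series of the E k bound the premeasure of A. *)
Lemma hausdorff_delta_borel_cantelli (R : realType) (s delta C : R)
    (A : set R) (E : nat -> set R) : 0 <= C ->
  (forall k0, A `<=` [set x | exists2 k, (k0 <= k)%N & E k x]) ->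
  (forall k, (0 < k)%N -> (hausdorff_delta s delta (E k) <= (C / k%:R ^+ 2)%:E)%E) ->
  hausdorff_delta s delta A = 0%E.
Proof.
move=> C0 AE EC; apply/eqP; rewrite eq_le hausdorff_delta_ge0 andbT.
apply/lee_addgt0Pr => e e0; rewrite add0e.
pose k0 := (Num.truncn (2 * C / e)).+1.
have k0P : 2 * C / e < k0%:R by exact: truncnS_gt.
have k00 : 0 < k0%:R :> R by rewrite ltr0n.
apply: (@le_trans _ _ (hausdorff_delta s delta (\bigcup_n E (k0 + n)%N))).
  apply: le_hausdorff_delta => x /(AE k0)[k kk Ek].
  by exists (k - k0)%N => //; rewrite subnKC.
apply: le_trans (hausdorff_delta_subadditive _ _ _ _) _.
apply: lime_le; first by apply: is_cvg_nneseries => n _ _; exact: hausdorff_delta_ge0.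
apply: nearW => n.
apply: (@le_trans _ _ (\sum_(0 <= k < n) (C / (k0 + k)%:R ^+ 2)%:E)%E).
  by apply: lee_sum => k _; exact: EC.
rewrite sumEFin lee_fin -mulr_sumr.
apply: le_trans (ler_wpM2l C0 (@sum_inv_sqr_le R k0 n isT)) _.
apply: (@le_trans _ _ (C * (2 / k0%:R))).
  by rewrite ler_wpM2l// gerBl divr_ge0// ler0n.
rewrite mulrA ler_pdivrMr//; move: k0P; rewrite ltr_pdivrMr// => ?; lra.
Qed.

(** * Local Lipschitz bounds *)

(** The quantitative form serves twice: it transfers a value of a Weyl sum to
    the nearest endpoint, and it gives the continuity from which measurability
    follows. *)
Definition locally_lipschitz (R : realType) (f : R -> R) : Prop :=
  forall X, 0 <= X -> exists2 M, 0 <= M &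
    forall x y, `|x| <= X -> `|y| <= X -> `|f x - f y| <= M * `|x - y|.

Lemma locally_lipschitz_cst (R : realType) (c : R) :
  locally_lipschitz R (fun=> c).
Proof. by move=> X X0; exists 0 => // x y _ _; rewrite subrr normr0 mul0r. Qed.

Lemma locally_lipschitzD (R : realType) (f g : R -> R) :
  locally_lipschitz R f -> locally_lipschitz R g ->
  locally_lipschitz R (fun x => f x + g x).
Proof.
move=> hf hg X X0; have [M M0 fM] := hf X X0; have [L L0 gL] := hg X X0.
exists (M + L); first exact: addr_ge0.
move=> x y xX yX; rewrite opprD addrACA mulrDl.
by apply: le_trans (ler_normD _ _) _; rewrite lerD ?fM ?gL.
Qed.

Lemma locally_lipschitzM (R : realType) (f g : R -> R) :
  locally_lipschitz R f -> locally_lipschitz R g ->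
  locally_lipschitz R (fun x => f x * g x).
Proof.
move=> hf hg X X0; have [M M0 fM] := hf X X0; have [L L0 gL] := hg X X0.
have bnd (F : R -> R) (K : R) : 0 <= K ->
    (forall x y, `|x| <= X -> `|y| <= X -> `|F x - F y| <= K * `|x - y|) ->
    forall x, `|x| <= X -> `|F x| <= `|F 0| + K * X.
  move=> K0 FK x xX; rewrite -[F x](subrK (F 0)) addrC.
  apply: le_trans (ler_normD _ _) _; rewrite lerD2l.
  apply: le_trans (FK _ _ xX _) _; first by rewrite normr0.
  by rewrite subr0 ler_wpM2l.
exists ((`|f 0| + M * X) * L + (`|g 0| + L * X) * M).
  by rewrite addr_ge0// mulr_ge0// addr_ge0// mulr_ge0.
move=> x y xX yX.
have -> : f x * g x - f y * g y = f x * (g x - g y) + g y * (f x - f y) by ring.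
apply: le_trans (ler_normD _ _) _; rewrite !normrM mulrDl -!mulrA.
by rewrite lerD// ler_pM// ?(bnd _ _ M0 fM) ?(bnd _ _ L0 gL) ?fM ?gL.
Qed.

Lemma locally_lipschitz_comp (R : realType) (F f : R -> R) :
  (forall x y, `|F x - F y| <= `|x - y|) ->
  locally_lipschitz R f -> locally_lipschitz R (fun x => F (f x)).
Proof.
move=> hF hf X X0; have [M M0 fM] := hf X X0; exists M => // x y xX yX.
exact: le_trans (hF _ _) (fM _ _ xX yX).
Qed.

Lemma sin_lipschitz (R : realType) (x y : R) : `|sin x - sin y| <= `|x - y|.
Proof.
rewrite -(cosBpihalf x) -(cosBpihalf y).
have -> : x - y = x - pi / 2 - (y - pi / 2) by ring.
exact: cos_lipschitz.
Qed.

Lemma locally_lipschitzX (R : realType) (n : nat) :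
  locally_lipschitz R (fun x => x ^+ n).
Proof.
elim: n => [|n IH].
  have -> : (fun x : R => x ^+ 0) = (fun=> 1) by apply/funext => x; rewrite expr0.
  exact: locally_lipschitz_cst.
have -> : (fun x : R => x ^+ n.+1) = (fun x => x * x ^+ n).
  by apply/funext => x; rewrite exprS.
apply: locally_lipschitzM IH => X X0; exists 1 => // x y _ _.
by rewrite mul1r.
Qed.

Lemma locally_lipschitz_sum (R : realType) (r : seq nat) (F : nat -> R -> R) :
  (forall i, locally_lipschitz R (F i)) ->
  locally_lipschitz R (fun x => \sum_(i <- r) F i x).
Proof.
move=> hF; elim: r => [|i r IH].
  have -> : (fun x : R => \sum_(i <- [::]) F i x) = (fun=> 0).
    by apply/funext => x; rewrite big_nil.
  exact: locally_lipschitz_cst.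
have -> : (fun x : R => \sum_(j <- i :: r) F j x) =
          (fun x => F i x + \sum_(j <- r) F j x).
  by apply/funext => x; rewrite big_cons.
exact: locally_lipschitzD.
Qed.

Lemma locally_lipschitz_weyl_sqr (R : realType) (h N : nat) :
  locally_lipschitz R (fun x => weyl_sqr R h (fun n => x ^+ n) N).
Proof.
have lin n : locally_lipschitz R (fun x => 2 * pi * h%:R * x ^+ n).
  apply: locally_lipschitzM; last exact: locally_lipschitzX.
  exact: locally_lipschitz_cst.
have hc : locally_lipschitz R
    (fun x => \sum_(1 <= n < N.+1) cos (2 * pi * h%:R * x ^+ n)).
  apply: locally_lipschitz_sum => n.
  exact: (@locally_lipschitz_comp R cos _ (@cos_lipschitz R)).
have hs : locally_lipschitz R
    (fun x => \sum_(1 <= n < N.+1) sin (2 * pi * h%:R * x ^+ n)).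
  apply: locally_lipschitz_sum => n.
  exact: (@locally_lipschitz_comp R sin _ (@sin_lipschitz R)).
rewrite /weyl_sqr; under eq_fun => x do rewrite !expr2.
by apply: locally_lipschitzD; apply: locally_lipschitzM.
Qed.

Lemma locally_lipschitz_continuous (R : realType) (f : R -> R) :
  locally_lipschitz R f -> continuous f.
Proof.
move=> hf x; have X0 : 0 <= `|x| + 1 by rewrite addr_ge0.
have [M M0 fM] := hf _ X0.
apply/cvgrPdist_le => e e0.
have d0 : 0 < Num.min 1 (e / (M + 1)).
  by rewrite lt_min ltr01 divr_gt0// ltr_wpDl.
near=> y.
have : `|x - y| <= Num.min 1 (e / (M + 1)).
  by near: y; apply: cvgr_dist_le.
rewrite le_min => /andP[y1 y2].
apply: le_trans (fM x y _ _) _; first by rewrite lerDl.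
  rewrite -[y](subrK x) addrC; apply: le_trans (ler_normD _ _) _.
  by rewrite lerD2l distrC.
have M1 : 0 < M + 1 by lra.
apply: (@le_trans _ _ ((M + 1) * `|x - y|)); first by rewrite ler_wpM2r//; lra.
by move: y2; rewrite ler_pdivlMr// mulrC.
Unshelve. all: by end_near. Qed.

(** * Covering the Cantor set *)

Lemma cantor_stage_cover (R : realType) (k : nat) (x : R) : cantor_stage R k x ->
  exists2 a, a \in cantor_points R k & a <= x <= a + (3 ^+ k)^-1.
Proof.
elim: k x => [|k IH] x /=.
  rewrite in_itv /= => x01; exists 0; first by rewrite inE.
  by rewrite expr0 invr1 add0r.
have e : (3 ^+ k.+1 : R)^-1 = (3 ^+ k)^-1 / 3 by rewrite exprS invfM mulrC.
case=> -[y /IH[a ak /andP[ay ya]] <-].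
  exists (a / 3); first by rewrite mem_cat (map_f (fun x => x / 3)).
  by rewrite e; apply/andP; split; lra.
exists (a / 3 + 2 / 3); first by rewrite mem_cat (map_f (fun x => x / 3 + 2 / 3)) ?orbT.
by rewrite e; apply/andP; split; lra.
Qed.

Lemma cantor_stage_bounds (R : realType) (k : nat) (x : R) :
  cantor_stage R k x -> 0 <= x <= 1.
Proof.
elim: k x => [|k IH] x /=; first by rewrite in_itv.
by case=> -[y /IH/andP[y0 y1] <-]; apply/andP; split; lra.
Qed.

(** The branch must be the same at every stage. The position of x relative to
    2/3 decides it, because the two thirds of a stage are disjoint. *)
Lemma cantor_set_split (R : realType) (x : R) : cantor_set R x ->
  exists2 z, cantor_set R z & x = z / 3 \/ x = z / 3 + 2 / 3.
Proof.
move=> Cx; have [x2|x2] := ltP x (2 / 3).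
  exists (x * 3); last by left; field.
  move=> k _; case: (Cx k.+1 I) => /= -[y yk yx]; first by rewrite -yx divfK.
  by have /andP[y0 _] := cantor_stage_bounds R k y yk; lra.
exists ((x - 2 / 3) * 3); last by right; field.
move=> k _; case: (Cx k.+1 I) => /= -[y yk yx]; last by rewrite -yx addrK divfK.
by have /andP[_ y1] := cantor_stage_bounds R k y yk; lra.
Qed.

Lemma cantor_set_cylinders (R : realType) (r : nat) (x : R) : cantor_set R x ->
  exists2 a, a \in cantor_points R r &
  exists2 z, cantor_set R z & x = a + (3 ^+ r)^-1 * z.
Proof.
elim: r x => [|r IH] x Cx.
  exists 0; first by rewrite inE.
  by exists x => //; rewrite expr0 invr1 mul1r add0r.
have [y Cy xy] := cantor_set_split R x Cx.
have [a ar [z Cz yE]] := IH y Cy.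
have p3 : 3 ^+ r != 0 :> R by rewrite expf_neq0.
case: xy => ->.
  exists (a / 3); first by rewrite mem_cat (map_f (fun x => x / 3)).
  by exists z => //; rewrite yE exprS; field.
exists (a / 3 + 2 / 3); first by rewrite mem_cat (map_f (fun x => x / 3 + 2 / 3)) ?orbT.
by exists z => //; rewrite yE exprS; field.
Qed.

(** * The exceptional set *)

(** The points where |S_N|^2 >= N^2 / (i + 1) for infinitely many squares
    N = k^2. It is defined on the whole line, so that it is a Borel set without
    reference to C. *)
Definition large_weyl_io (R : realType) (h i : nat) : set R :=
  \bigcap_k0 \bigcup_(k in [set k | (k0 <= k)%N])
    [set x | k%:R ^+ 4 <= i.+1%:R * weyl_sqr R h (fun n => x ^+ n) (k ^ 2)].

(** For each k take K so large that the Weyl sum of length k^2 hardly varies on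
    an interval of stage K. By Markov's inequality the proportion of intervals
    of stage K on which it is large is O(1 / k^2), which is summable. *)
Lemma large_weyl_io_null (R : realType) (delta beta lam v : R) (h i : nat) :
  1 < beta -> 0 < lam -> lam <= 1 -> 1 < v -> v ^+ 96 <= beta ->
  beta + lam <= beta * v ^+ 3 -> (0 < h)%N -> 0 < delta ->
  hausdorff_delta (ln 2 / ln 3) delta
    (large_weyl_io R h i `&` [set beta + lam * z | z in cantor_set R]) = 0%E.
Proof.
move=> b1 l0 l1 v1 vb bv h0 d0.
have [C C0 CP] := @mean_weyl_sqr R beta lam v h b1 l0 l1 v1 vb bv h0.
pose W k x := weyl_sqr R h (fun n => x ^+ n) (k ^ 2).
pose E k := [set x | k%:R ^+ 4 <= i.+1%:R * W k x] `&`
            [set beta + lam * z | z in cantor_set R].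
apply: (@hausdorff_delta_borel_cantelli R _ _ (2 * C * i.+1%:R) _ E).
- by rewrite !mulr_ge0// ler0n.
- by move=> k0 x [xio xC]; have [k /= kk kx] := xio k0 I; exists k.
move=> k k00; have i0 : 0 < i.+1%:R :> R by rewrite ltr0n.
have k0R : 0 < k%:R :> R by rewrite ltr0n.
have [K0 K0P] := CP (k ^ 2)%N.
have X0 : 0 <= beta + lam by lra.
have [M M0 MP] := locally_lipschitz_weyl_sqr R h (k ^ 2) _ X0.
pose thr := k%:R ^+ 4 / (2 * i.+1%:R) : R.
have thr0 : 0 < thr by rewrite divr_gt0 ?exprn_gt0 ?mulr_gt0.
pose T := M / thr + delta^-1.
pose K := (K0 + (Num.truncn T).+1)%N.
have TK : T <= 3 ^+ K.
  apply/ltW/(lt_le_trans (truncnS_gt _)); rewrite -natrX ler_nat.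
  apply: leq_trans (leq_addl K0 _) _; exact/ltnW/ltn_expl.
have K3 : 0 < 3 ^+ K :> R by rewrite exprn_gt0.
have di0 : 0 < delta^-1 by rewrite invr_gt0.
have MT : M / 3 ^+ K <= thr.
  rewrite ler_pdivrMr// mulrC -ler_pdivrMr//; apply: le_trans TK.
  by rewrite lerDl ltW.
have dK : (3 ^+ K)^-1 <= delta.
  rewrite -[delta]invrK lef_pV2 ?posrE//; apply: le_trans TK.
  by rewrite lerDr divr_ge0// ltW.
pose p := [seq c <- cantor_points R K | thr <= W k (beta + lam * c)].
pose q := [seq beta + lam * c | c <- p].
have Eq : E k `<=` [set x | exists2 a, a \in q & a <= x <= a + lam * (3 ^+ K)^-1].
  move=> x [/= + [z Cz xz]]; rewrite -{}xz => Wx.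
  have [c cK /andP[cz zc]] := cantor_stage_cover R K z (Cz K I).
  have /andP[z0 z1] := cantor_stage_bounds R K z (Cz K I).
  have /andP[c0 c1] := cantor_points_bounds R K c cK.
  have c11 : c <= 1.
    by apply: le_trans c1 _; rewrite lerBlDr lerDl invr_ge0 ltW.
  exists (beta + lam * c); last first.
    by apply/andP; split; [rewrite lerD2l ler_pM2l|
                           rewrite -addrA -mulrDr lerD2l ler_pM2l].
  apply: (map_f (fun c => beta + lam * c)); rewrite mem_filter cK andbT.
  have nb y : 0 <= y -> y <= 1 -> `|beta + lam * y| <= beta + lam.
    move=> y0 y1; rewrite ger0_norm; last by rewrite addr_ge0 ?mulr_ge0//; lra.
    by rewrite lerD2l ler_piMr// ltW.
  have dW : W k (beta + lam * z) - W k (beta + lam * c) <= thr.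
    apply: le_trans (ler_norm _) _.
    apply: le_trans (MP _ _ (nb z z0 z1) (nb c c0 c11)) _.
    apply: le_trans MT; rewrite ler_wpM2l//.
    have -> : beta + lam * z - (beta + lam * c) = lam * (z - c) by ring.
    rewrite normrM !ger0_norm ?subr_ge0 ?(ltW l0)//.
    apply: (@le_trans _ _ (1 * (z - c))); last by rewrite mul1r; lra.
    by rewrite ler_wpM2r ?subr_ge0.
  have : 2 * thr <= W k (beta + lam * z).
    have -> : 2 * thr = k%:R ^+ 4 / i.+1%:R by rewrite /thr; field; rewrite gt_eqF.
    by rewrite ler_pdivrMr// mulrC.
  lra.
have sp : thr * (size p)%:R <= 2 ^+ K * (C * k%:R ^+ 2).
  rewrite -[k%:R ^+ 2]natrX; apply: le_trans (K0P K (leq_addr _ _)).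
  rewrite size_filter -sum1_count natr_sum mulr_sumr big_mkcond /=.
  apply: ler_sum => c _; case: ifP => [|_]; first by rewrite mulr1.
  by rewrite addr_ge0// sqr_ge0.
apply: le_trans (@hausdorff_delta_finite_cover R delta (lam * (3 ^+ K)^-1) K q (E k) _ _ d0 Eq) _.
- by rewrite ler_piMl// invr_ge0 ltW.
- by apply: le_trans dK; rewrite ler_piMl// invr_ge0 ltW.
rewrite lee_fin size_map ler_pdivrMr ?exprn_gt0//.
rewrite -(ler_pM2l thr0); apply: le_trans sp _.
by rewrite le_eqVlt; apply/orP; left; apply/eqP; rewrite /thr; field; rewrite !gt_eqF.
Qed.

Lemma measurable_large_weyl_io (R : realType) (h i : nat) :
  measurable (large_weyl_io R h i : set (measurableTypeR R)).
Proof.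
apply: bigcapT_measurable => k0; apply: bigcup_measurable => k _.
apply: closed_measurable.
apply: (@preimage_closed _ _ (fun x : R => i.+1%:R * weyl_sqr R h (fun n => x ^+ n) (k ^ 2))
          [set y | k%:R ^+ 4 <= y]); last exact: closed_ge.
move=> x _; apply: locally_lipschitz_continuous.
apply: locally_lipschitzM; first exact: locally_lipschitz_cst.
exact: locally_lipschitz_weyl_sqr.
Qed.

Lemma hausdorff_delta_set1 (R : realType) (delta x : R) : 0 < delta ->
  hausdorff_delta (ln 2 / ln 3) delta [set x] = 0%E.
Proof.
move=> d0; apply/eqP; rewrite eq_le hausdorff_delta_ge0 andbT.
apply/lee_addgt0Pr => e e0; rewrite add0e.
pose K := (Num.truncn e^-1).+1.
apply: le_trans (@hausdorff_delta_finite_cover R delta 0 K [:: x] [set x] _ _ d0 _) _.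
- by rewrite invr_ge0 exprn_ge0.
- exact: ltW.
- by move=> _ ->; exists x; rewrite ?inE// addr0 lexx.
rewrite lee_fin mul1r -[e]invrK lef_pV2 ?posrE ?exprn_gt0 ?invr_gt0//.
apply/ltW/(lt_trans (truncnS_gt _)); rewrite -natrX ltr_nat; exact: ltn_expl.
Qed.

(** A point x > 1 of C + t lies in the cylinder of depth r around it, whose
    left endpoint beta is at least b0 = (1 + x) / 2 for large r. The number v is
    fixed by v^96 = b0 before r is chosen, and then beta + 3^-r <= beta v^3 for
    large r. *)
Lemma hausdorff_delta_large_weyl_io (R : realType) (delta t : R) (h i : nat) :
  1 <= t -> (0 < h)%N -> 0 < delta ->
  hausdorff_delta (ln 2 / ln 3) delta
    (large_weyl_io R h i `&` [set c + t | c in cantor_set R]) = 0%E.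
Proof.
move=> t1 h0 d0.
pose good (beta lam : R) := exists v : R,
  [/\ 1 < beta, 1 < v, v ^+ 96 <= beta & beta + lam <= beta * v ^+ 3].
pose base r j := t + nth 0 (cantor_points R r) j.
pose piece r j := [set x | good (base r j) (3 ^+ r)^-1 /\
  (large_weyl_io R h i `&` [set base r j + (3 ^+ r)^-1 * z | z in cantor_set R]) x].
have piece0 r j : hausdorff_delta (ln 2 / ln 3) delta (piece r j) = 0%E.
  have l0 : 0 < (3 ^+ r)^-1 :> R by rewrite invr_gt0 exprn_gt0.
  apply/eqP; rewrite eq_le hausdorff_delta_ge0 andbT.
  have [[v [b1 v1 vb bv]]|ngood] := pselect (good (base r j) (3 ^+ r)^-1).
    rewrite -(@large_weyl_io_null R delta (base r j) (3 ^+ r)^-1 v h i)//.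
      by apply: le_hausdorff_delta => x [].
    by rewrite invf_le1 ?exprn_gt0// exprn_ege1// ler1n.
  rewrite -(hausdorff_delta_set1 R delta 0 d0).
  by apply: le_hausdorff_delta => x [].
pose U n := if n is r.+1 then \bigcup_j piece r j else [set 1].
have U0 n : hausdorff_delta (ln 2 / ln 3) delta (U n) = 0%E.
  case: n => [|r] /=; first exact: hausdorff_delta_set1.
  exact: hausdorff_delta_bigcup0.
apply/eqP; rewrite eq_le hausdorff_delta_ge0 andbT.
rewrite -(hausdorff_delta_bigcup0 R _ _ U U0).
apply: le_hausdorff_delta => x [xio [c Cc xE]].
have /andP[c0 c1] := cantor_stage_bounds R 0 c (Cc 0%N I).
have [x1|x1] := leP x 1; first by exists 0%N => //=; lra.
pose b0 := (1 + x) / 2.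
have b01 : 1 < b0 by rewrite /b0; lra.
pose v := expR (ln b0 / 96%:R).
have v1 : 1 < v by rewrite expR_gt1 divr_gt0 ?ln_gt0.
have v31 : 1 < v ^+ 3 by rewrite exprn_egt1.
pose T := (x - b0)^-1 + (v ^+ 3 - 1)^-1.
have xb : 0 < x - b0 by rewrite /b0; lra.
have v30 : 0 < v ^+ 3 - 1 by lra.
have [r Tr] : exists r, T <= 3 ^+ r.
  exists (Num.truncn T).+1; apply/ltW/(lt_trans (truncnS_gt _)).
  by rewrite -natrX ltr_nat ltn_expl.
have l1 : (3 ^+ r)^-1 <= x - b0.
  rewrite -[x - b0]invrK lef_pV2 ?posrE ?exprn_gt0 ?invr_gt0//.
  by apply: le_trans Tr; rewrite lerDl invr_ge0 ltW.
have l2 : (3 ^+ r)^-1 <= v ^+ 3 - 1.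
  rewrite -[v ^+ 3 - 1]invrK lef_pV2 ?posrE ?exprn_gt0 ?invr_gt0//.
  by apply: le_trans Tr; rewrite lerDr invr_ge0 ltW.
have [a ar [z Cz cE]] := cantor_set_cylinders R r c Cc.
have /andP[z0 z1] := cantor_stage_bounds R 0 z (Cz 0%N I).
have l0 : 0 < (3 ^+ r)^-1 :> R by rewrite invr_gt0 exprn_gt0.
have bE : base r (index a (cantor_points R r)) = t + a by rewrite /base nth_index.
have lz : (3 ^+ r)^-1 * z <= (3 ^+ r)^-1 by rewrite ler_piMr// ltW.
have ba : b0 <= t + a by rewrite -xE cE in l1; lra.
exists r.+1 => //=; exists (index a (cantor_points R r)) => //.
rewrite /piece /= bE; split.
  exists v; split; [lra|by []| |].
    by rewrite -expRM_natr divfK ?pnatr_eq0// lnK// posrE; lra.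
  have : 1 * (v ^+ 3 - 1) <= (t + a) * (v ^+ 3 - 1) by rewrite ler_wpM2r ?(ltW v30)//; lra.
  lra.
by split => //; exists z => //; rewrite -xE cE; ring.
Qed.

Theorem corollary2p2 (R : realType) (t : R) (ht : 1 <= t) :
  {ae hausdorff_restr (ln 2 / ln 3) [set c + t | c in cantor_set R],
    forall x : R, uniformly_distributed_mod1 (fun n : nat => x ^+ n)}.
Proof.
exists (\bigcup_h \bigcup_i large_weyl_io R h.+1 i); split.
- apply: bigcupT_measurable => h; apply: bigcupT_measurable => i.
  exact: measurable_large_weyl_io.
- rewrite /hausdorff_restr setI_bigcupl.
  apply: hausdorff_measure0 => delta d0; apply: hausdorff_delta_bigcup0 => h.
  rewrite setI_bigcupl; apply: hausdorff_delta_bigcup0 => i.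
  exact: hausdorff_delta_large_weyl_io.
move=> x /=; apply: contra_notP => nio.
apply: uniformly_distributed_of_weyl => -[//|h] _ i.
have : ~ large_weyl_io R h.+1 i x by move=> w; apply: nio; exists h => //; exists i.
move=> /existsNP[k0 /not_implyP[_ nk]]; exists k0 => k kk.
by rewrite ltNge; apply/negP => le; apply: nk; exists k.
Qed.
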